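(* Let $n,\ell\ge1$ and let $k=(k_1,\dots,k_\ell)$ be a partition of $n$. Let $a\in L^\infty(\mathbb{P}^n(\mathbb{C}))$ be a $k$-quasi-radial symbol, and for every $j=1,\dots,\ell$ let $\psi_j\in L^\infty(\mathbb{P}^n(\mathbb{C}))$ be a symbol of the form $$\psi_j(z)=b_j(\sigma_{(j)})\,t_{(j)}^{p_j},\qquad z\in\mathbb{C}^n\subset\mathbb{P}^n(\mathbb{C}),$$ where $b_j\in L^\infty(\Sigma_j)$ and $p_j\in\mathbb{Z}^{k_j}$ satisfies $|p_j|=0$. Then the Toeplitz operators $T_a,T_{\psi_1},\dots,T_{\psi_\ell}$ pairwise commute on every weighted Bergman space $\mathcal{A}^2_m(\mathbb{P}^n(\mathbb{C}))$, $m\in\mathbb{N}$.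
   Context: Bergman space and Toeplitz operators. $\mathbb{N}=\{0,1,2,\dots\}$. $\mathbb{C}^n$ is embedded in $\mathbb{P}^n(\mathbb{C})$ by $z\mapsto[1,z]$ (complement of measure zero), so $L^\infty(\mathbb{P}^n(\mathbb{C}))=L^\infty(\mathbb{C}^n)$. For $m\in\mathbb{N}$ the weighted Bergman space $\mathcal{A}^2_m(\mathbb{P}^n(\mathbb{C}))$ is identified with the space $\mathcal{P}_m(\mathbb{C}^n)$ of holomorphic polynomials on $\mathbb{C}^n$ of degree at most $m$, a closed subspace of $L^2(\mathbb{C}^n,\nu_m)$, where $$d\nu_m(z)=\frac{(n+m)!}{\pi^n m!}\frac{dV(z)}{(1+|z_1|^2+\dots+|z_n|^2)^{n+m+1}}$$ and $dV$ is Lebesgue measure. With $B_m:L^2(\mathbb{C}^n,\nu_m)\to\mathcal{P}_m(\mathbb{C}^n)$ the orthogonal projection, $T_\psi f=B_m(\psi f)$ for $\psi\in L^\infty(\mathbb{C}^n)$, $f\in\mathcal{P}_m(\mathbb{C}^n)$. For an integer multi-index (possibly with negative entries), $|\cdot|$ denotes the sum of its entries. Coordinates. A partition of $n$ is $k=(k_1,\dots,k_\ell)$ with integers $k_j\ge1$, $k_1+\dots+k_\ell=n$. It splits every $n$-tuple $x$ into consecutive blocks $x_{(1)},\dots,x_{(\ell)}$ of lengths $k_1,\dots,k_\ell$. For $z\in\mathbb{C}^n$ (a.e.) put $t_u=z_u/|z_u|$, $r=|z|$ (Euclidean norm), $\sigma_u=|z_u|/r$ for $u=1,\dots,n$, so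 $\sigma=(\sigma_1,\dots,\sigma_n)\in S_+^{n-1}$, the part of the unit sphere of $\mathbb{R}^n$ with nonnegative coordinates; $t_{(j)}^{p_j}$ is the monomial in the entries of $t_{(j)}$ with exponents $p_j$. $\Sigma_j=\{\sigma_{(j)}:\sigma\in S_+^{n-1}\}$, i.e. the part of the closed unit ball of $\mathbb{R}^{k_j}$ with nonnegative coordinates if $\ell\ge2$ (with Lebesgue measure) and $S_+^{n-1}$ if $\ell=1$ (with surface measure). $k$-quasi-radial symbols: $a\in L^\infty(\mathbb{P}^n(\mathbb{C}))$ of the form $a([1,z])=\widetilde a(|z_{(1)}|,\dots,|z_{(\ell)}|)$, $z\in\mathbb{C}^n$, for some function $\widetilde a$ on $[0,\infty)^\ell$. *)

(* Defs.v *)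
From HB Require Import structures.
From mathcomp Require Import all_boot all_order all_algebra.
From mathcomp Require Import complex.
From mathcomp Require Import (canonicals, coercions) mpoly.
From mathcomp Require Import all_classical all_reals all_analysis.
From mathcomp Require Import measurable_realfun.

Set Implicit Arguments.
Unset Strict Implicit.
Unset Printing Implicit Defensive.

Import Order.TTheory GRing.Theory Num.Theory.
Import numFieldNormedType.Exports.
Import ComplexField.Normc.

Local Open Scope classical_set_scope.
Local Open Scope ring_scope.
Local Open Scope complex_scope.

Definition tcons (T : Type) n (p : T * n.-tuple T) : n.+1.-tuple T :=
  [tuple of p.1 :: p.2].

Lemma measurable_tcons d (T : measurableType d) n :
  measurable_fun [set: T * n.-tuple T] (@tcons T n).
Proof. by apply: measurable_cons. Qed.

Section cons_measure.
Local Open Scope ereal_scope.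
Context d (T : measurableType d) (R : realType) (n : nat).
Variable m1 : {sigma_finite_measure set T -> \bar R}.
Variable m2 : {sigma_finite_measure set (n.-tuple T) -> \bar R}.

Definition cons_measure (A : set (n.+1.-tuple T)) : \bar R :=
  (m1 \x m2) (@tcons T n @^-1` A).

Let mpre (A : set (n.+1.-tuple T)) :
  measurable A -> measurable (@tcons T n @^-1` A).
Proof. by move=> mA; rewrite -[X in measurable X]setTI; exact: measurable_tcons. Qed.

Let cons_measure0 : cons_measure set0 = 0.
Proof. by rewrite /cons_measure preimage_set0 measure0. Qed.

Let cons_measure_ge0 A : 0 <= cons_measure A.
Proof. exact: measure_ge0. Qed.

Let cons_measure_sigma_additive : semi_sigma_additive cons_measure.
Proof.
move=> F mF tF mUF; rewrite /cons_measure preimage_bigcup.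
apply: measure_semi_sigma_additive.
- by move=> i; exact: mpre.
- apply/trivIsetP => /= i j _ _ ij; rewrite -preimage_setI.
  by move/trivIsetP : tF => /(_ _ _ _ _ ij) ->//; rewrite preimage_set0.
- by rewrite -preimage_bigcup; exact: mpre.
Qed.

HB.instance Definition _ := isMeasure.Build _ _ _ cons_measure
  cons_measure0 cons_measure_ge0 cons_measure_sigma_additive.

Let cons_measure_sigma_finite : sigma_finite setT cons_measure.
Proof.
have /sigma_finiteP[F [TF ndF Foo]] := sigma_finiteT m1.
have /sigma_finiteP[G [TG ndG Goo]] := sigma_finiteT m2.
exists (fun i => [set t | F i (thead t) /\ G i [tuple of behead t]]).
  apply/esym; rewrite -subTset => t _.
  have [i _ Fi] : (\bigcup_i F i) (thead t) by rewrite -TF.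
  have [j _ Gj] : (\bigcup_j G j) [tuple of behead t] by rewrite -TG.
  exists (maxn i j) => //; split.
    by move: Fi; exact/subsetPset/ndF/leq_maxl.
  by move: Gj; exact/subsetPset/ndG/leq_maxr.
move=> i; have [mFi Fioo] := Foo i; have [mGi Gioo] := Goo i; split.
  apply: measurableI.
    by rewrite -[X in measurable X]setTI; exact: measurable_tnth.
  by rewrite -[X in measurable X]setTI; exact: measurable_behead.
rewrite /cons_measure (_ : _ @^-1` _ = F i `*` G i).
  by rewrite product_measure1E// lte_mul_pinfty// ge0_fin_numE.
have theadK (p : T * n.-tuple T) : thead (tcons p) = p.1 by rewrite theadE.
have tbeheadK (p : T * n.-tuple T) : [tuple of behead (tcons p)] = p.2.
  exact: val_inj.
by apply/seteqP; split => p; rewrite /preimage /setX /mkset theadK tbeheadK.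
Qed.

HB.instance Definition _ := Measure_isSigmaFinite.Build _ _ _ cons_measure
  cons_measure_sigma_finite.

End cons_measure.

Notation Rn R n := (n.-tuple (measurableTypeR R)).

Fixpoint leb (R : realType) (n : nat) :
    {sigma_finite_measure set (Rn R n) -> \bar R} :=
  match n return {sigma_finite_measure set (Rn R n) -> \bar R} with
  | 0 => dirac ([tuple] : Rn R 0)
  | n'.+1 => cons_measure (@lebesgue_measure R) (leb R n')
  end.

Section sphere.
Variables (R : realType) (n : nat).
Implicit Types x : Rn R n.

Definition enorm x : R := Num.sqrt (\sum_(i < n) (tnth x i : R) ^+ 2).

Definition normalize x : Rn R n := [tuple (tnth x i : R) / enorm x | i < n].

Definition sphere_nneg : set (Rn R n) :=
  [set x | enorm x = 1 /\ forall i, 0 <= (tnth x i : R)].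

Let mtnth i : measurable_fun setT (fun x => tnth x i : R).
Proof. exact: measurable_tnth. Qed.

Lemma measurable_enorm : measurable_fun setT enorm.
Proof.
have -> : enorm = (fun x => (\sum_(i < n) (tnth x i : R) ^+ 2) `^ 2^-1).
  apply/funext => x; rewrite powR12_sqrt//.
  by apply: sumr_ge0 => i _; exact: sqr_ge0.
apply: (measurableT_comp (measurable_powR _)); apply: measurable_sum => i.
exact: measurable_funX.
Qed.

Lemma measurable_normalize : measurable_fun setT normalize.
Proof.
apply/measurable_fun_tnthP => i.
have -> : @tnth _ _ ^~ i \o normalize =
    (fun x => (tnth x i : R) * enorm x `^ (-1)) :> (_ -> R).
  by apply/funext => x /=; rewrite tnth_mktuple powR_inv1// sqrtr_ge0.
apply: measurable_funM => //.
by apply: (measurableT_comp (measurable_powR _)); exact: measurable_enorm.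
Qed.

Let ball_measurable : measurable [set x | enorm x <= 1].
Proof.
rewrite (_ : [set x | _] = setT `&` enorm @^-1` `]-oo, 1]).
  by apply: measurable_enorm.
by apply/seteqP; split => x /=; rewrite in_itv//=; case.
Qed.

(* Cone measure: the surface measure of a subset A of the unit sphere is n times
   the volume of the cone {x : |x| <= 1, x / |x| in A}. Since [normalize] maps 0
   to 0, all the mass is on the sphere for n >= 1. *)
Definition surface_measure (A : set (Rn R n)) : \bar R :=
  (n%:R%:E * leb R n (normalize @^-1` A `&` [set x | (enorm x <= 1)%R]))%E.

Let mcone A : measurable A ->
  measurable (normalize @^-1` A `&` [set x | enorm x <= 1]).
Proof.
move=> mA; apply: measurableI => //.
by rewrite -[X in measurable X]setTI; exact: measurable_normalize.
Qed.

Let surface_measure0 : surface_measure set0 = 0%E.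
Proof. by rewrite /surface_measure preimage_set0 set0I measure0 mule0. Qed.

Let surface_measure_ge0 A : (0 <= surface_measure A)%E.
Proof. by rewrite mule_ge0// lee_fin. Qed.

Let surface_measure_sigma_additive : semi_sigma_additive surface_measure.
Proof.
move=> F mF tF mUF; rewrite /surface_measure.
rewrite [X in X @ _ --> _](_ : _ = (fun k => n%:R%:E * \sum_(0 <= i < k)
    leb R n (normalize @^-1` (F i) `&` [set x | (enorm x <= 1)%R]))%E); last first.
  by apply/funext => k; rewrite ge0_sume_distrr.
apply: cvgeZl => //; rewrite preimage_bigcup setI_bigcupl.
apply: measure_semi_sigma_additive.
- by move=> i; exact: mcone.
- apply/trivIsetP => /= i j _ _ ij; rewrite setIACA -preimage_setI.
  by move/trivIsetP : tF => /(_ _ _ _ _ ij) ->//; rewrite preimage_set0 set0I.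
- by rewrite -setI_bigcupl -preimage_bigcup; exact: mcone.
Qed.

HB.instance Definition _ := isMeasure.Build _ _ _ surface_measure
  surface_measure0 surface_measure_ge0 surface_measure_sigma_additive.

End sphere.

Section complex_valued.
Context d (T : measurableType d) (R : realType).
Variable mu : {measure set T -> \bar R}.
Implicit Types f : T -> R[i].

Definition cintegral f : R[i] :=
  (\int[mu]_x complex.Re (f x)) +i* (\int[mu]_x complex.Im (f x)).

(* Representatives are Borel functions; every Lebesgue class has one. *)
Definition Linfty (D : set T) f : Prop :=
  [/\ measurable_fun D (fun x => complex.Re (f x)),
      measurable_fun D (fun x => complex.Im (f x)) &
      exists M : R, \forall x \ae mu, D x -> normc (f x) <= M].

End complex_valued.

(* z : Cn R n is the point z.1 + i z.2 of C^n. *)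
Notation Cn R n := (Rn R n * Rn R n)%type.

Section bergman.
Variables (R : realType) (n : nat).
Implicit Types (z : Cn R n) (m : nat) (psi f g : Cn R n -> R[i]).

Definition dV : {measure set (Cn R n) -> \bar R} := (leb R n \x leb R n)%E.

Definition zcoord z (u : 'I_n) : R[i] :=
  (tnth z.1 u : R) +i* (tnth z.2 u : R).

Definition moduli z : Rn R n := [tuple normc (zcoord z u) | u < n].

Definition sigma z : Rn R n := normalize (moduli z).

Definition tcoord z (u : 'I_n) : R[i] := zcoord z u / (normc (zcoord z u))%:C.

(* d nu_m = nu_density m dV *)
Definition nu_density m z : R :=
  (n + m)`!%:R / (pi ^+ n * m`!%:R) / (1 + enorm (moduli z) ^+ 2) ^+ (n + m + 1).

Definition inner m f g : R[i] :=
  cintegral dV (fun z => f z * (g z)^* * (nu_density m z)%:C).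

(* [mpoly.msize] is the total degree plus one. Polynomials are identified with
   their evaluations, so that A^2_m is a space of functions on C^n. *)
Definition bergman m : set (Cn R n -> R[i]) :=
  [set f | exists p : mpoly.mpoly n R[i],
    (mpoly.msize p <= m.+1)%N /\ f = (fun z => mpoly.meval (zcoord z) p)].

(* The orthogonal projection B_m of L^2(C^n, nu_m) onto P_m(C^n): [bproj m f] is
   the element g of P_m(C^n) such that f - g is orthogonal to P_m(C^n). The
   default value 0 of [xget] is not reached for f in L^2(C^n, nu_m). *)
Definition bproj m f : Cn R n -> R[i] :=
  xget (fun=> 0) [set g | bergman m g /\
    forall h, bergman m h -> inner m (fun z => f z - g z) h = 0].

Definition toeplitz m psi f : Cn R n -> R[i] := bproj m (fun z => psi z * f z).

Definition toeplitz_commute m psi phi : Prop :=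
  forall f, bergman m f ->
    toeplitz m psi (toeplitz m phi f) = toeplitz m phi (toeplitz m psi f).

End bergman.

Section partitions.
Variables (R : realType) (n l : nat) (k : 'I_l -> nat).
Hypothesis kn : (\sum_(j < l) k j)%N = n.

(* The position k_1 + ... + k_(j-1) + i of the i-th entry of the j-th block *)
Definition block_index (j : 'I_l) (i : 'I_(k j)) : 'I_n :=
  cast_ord kn (tagnat.Rank j i).

Definition block (T : Type) (x : n.-tuple T) (j : 'I_l) : (k j).-tuple T :=
  [tuple tnth x (block_index i) | i < k j].

(* Elements of L^infty are classes, hence the equality almost everywhere; nothing
   is assumed on a' (in particular no measurability). *)
Definition quasi_radial (a : Cn R n -> R[i]) : Prop :=
  Linfty (dV R n) setT a /\
  exists a' : l.-tuple R -> R[i],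
    \forall z \ae dV R n, a z = a' [tuple enorm (block (moduli z) j) | j < l].

Definition Sigma (j : 'I_l) : set (Rn R (k j)) :=
  [set block s j | s in @sphere_nneg R n].

Definition Sigma_measure (j : 'I_l) : {measure set (Rn R (k j)) -> \bar R} :=
  if l == 1 then (@surface_measure R (k j) : {measure set _ -> \bar R})
  else (leb R (k j) : {measure set _ -> \bar R}).

Definition block_monomial (j : 'I_l) (p : (k j).-tuple int) (z : Cn R n) : R[i] :=
  \prod_(i < k j) tcoord z (block_index i) ^ tnth p i.

End partitions.

Arguments Sigma R {n l k} kn j.
Arguments Sigma_measure R {l} k j.

(* Main.v *)
(* Each operator is a weighted shift on monomials: the action of the torus on
   C^n forces T z^a to be a multiple gamma(a) z^(a+p), where p is the torus
   weight of the symbol ([extend p_j] for psi_j, 0 for the quasi-radial symbol).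
   Two such shifts, with weights p and q supported on disjoint blocks, commute as
   soon as gamma is not affected by translating its argument by the other weight.
   The other weight has sum 0 on its block, and the symbol is invariant under the
   unitary group of that block. For a unitary W mixing z_u and z_v, comparing
   <phi (z_v^d o W), h> with <phi z_v^d, h o W^-1> on monomials shows that gamma
   does not depend on how the total degree d is shared between z_u and z_v, hence
   depends only on the total degree in the block. *)
Require Import Defs.
From mathcomp Require Import all_boot all_order all_algebra.
From mathcomp Require Import complex.
From mathcomp Require Import (canonicals, coercions) mpoly.
From mathcomp Require Import all_classical all_reals all_analysis.
From mathcomp Require Import measurable_realfun.
From mathcomp Require Import ring lra.

Set Implicit Arguments.
Unset Strict Implicit.
Unset Printing Implicit Defensive.

Import Order.TTheory GRing.Theory Num.Theory.
Import numFieldNormedType.Exports.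

Local Open Scope classical_set_scope.
Local Open Scope ring_scope.

Local Notation normc := ComplexField.Normc.normc.
Local Notation Re := complex.Re.
Local Notation Im := complex.Im.

(** * Measure-preserving maps *)

Section measure_preserving.
Context d1 d2 (T1 : measurableType d1) (T2 : measurableType d2) (R : realType).
Implicit Types (mu : {measure set T1 -> \bar R}).

(** Symbols are only given almost everywhere, so every symmetry is an a.e. identity and can be used
    only along maps that pull null sets back to null sets. The analytic input is therefore the
    invariance of [dV] under the unitaries, obtained from translations by Fubini. The cutoff at
    degree m does no harm because the weights have sum 0: an intermediate exponent has the degree of
    the initial one. Finally, the pairings themselves do depend on how d is shared: expanding z_v^d
    o W gives a factor ['C(d, e)], with e the exponent of z_u. The same factor occurs for the
    constant symbol 1, that is, for the squared norms of the monomials, so it disappears from the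
    quotient gamma. *)

Definition mpres d (T : measurableType d) (mu : set T -> \bar R) (f : T -> T) :=
  measurable_fun setT f /\ forall A, measurable A -> mu (f @^-1` A) = mu A.

Lemma mpres_comp d (T : measurableType d) (mu : set T -> \bar R) (f g : T -> T) :
  mpres mu f -> mpres mu g -> mpres mu (f \o g).
Proof.
move=> [mf fA] [mg gA]; split; first exact: measurableT_comp.
move=> A mA; rewrite comp_preimage gA ?fA//.
by rewrite -[X in measurable X]setTI; exact: mf.
Qed.

Lemma ge0_integral_mpres (mu : {measure set T1 -> \bar R}) f (g : T1 -> \bar R) :
  mpres mu f -> measurable_fun setT g -> (forall x, 0 <= g x)%E ->
  (\int[mu]_x g (f x) = \int[mu]_x g x)%E.
Proof.
move=> [mf fA] mg g0.
have := @ge0_integral_pushforward _ _ _ _ R f mf mu setT g measurableT mg (fun x _ => g0 x).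
rewrite preimage_setT => <-.
by apply: eq_measure_integral => A mA _; exact: fA.
Qed.

Lemma integral_mpres (mu : {measure set T1 -> \bar R}) f (g : T1 -> \bar R) :
  mpres mu f -> measurable_fun setT g ->
  (\int[mu]_x g (f x) = \int[mu]_x g x)%E.
Proof.
move=> fP mg; have [mf _] := fP.
rewrite integralE [RHS]integralE; congr (_ - _)%E.
  rewrite -(ge0_integral_mpres fP (measurable_funepos mg))//.
  by apply: eq_integral => x _; rewrite !funeposE.
rewrite -(ge0_integral_mpres fP (measurable_funeneg mg))//.
by apply: eq_integral => x _; rewrite !funenegE.
Qed.

Lemma ae_mpres (mu : {measure set T1 -> \bar R}) f (P : T1 -> Prop) :
  mpres mu f -> (\forall x \ae mu, P x) -> \forall x \ae mu, P (f x).
Proof.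
move=> [mf fA] [N [mN N0 PN]]; exists (f @^-1` N); split.
- by rewrite -[X in measurable X]setTI; exact: mf.
- by rewrite fA.
- by move=> x /= Pfx; exact: PN.
Qed.

Variables (m1 : {sigma_finite_measure set T1 -> \bar R}).
Variables (m2 : {sigma_finite_measure set T2 -> \bar R}).

(** Fubini: a section of the preimage is the preimage of a section under [g x], so both have the
    same measure. *)
Lemma mpres_sndfib (g : T1 -> T2 -> T2) :
  measurable_fun setT (fun z => g z.1 z.2) -> (forall x, mpres m2 (g x)) ->
  mpres (m1 \x m2)%E (fun z => (z.1, g z.1 z.2)).
Proof.
move=> mg gP.
have mf : measurable_fun setT (fun z : T1 * T2 => (z.1, g z.1 z.2)).
  by apply: measurable_fun_pair => //; exact: measurable_fst.
split => // A mA.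
rewrite /product_measure1; apply: eq_integral => x _ /=.
rewrite -[RHS](proj2 (gP x)); last exact: measurable_xsection.
by congr (m2 _); rewrite !xsectionE.
Qed.

(** Uniqueness of the product measure. It allows slicing the other way for a map acting on the first
    factor, whereas [\x] integrates over that factor. *)
Lemma product_measure12 A : measurable A -> (m1 \x m2)%E A = (m1 \x^ m2)%E A.
Proof.
by move=> mA; apply: product_measure_unique => // B C mB mC; exact: product_measure2E.
Qed.

Lemma mpres_fstfib (g : T2 -> T1 -> T1) :
  measurable_fun setT (fun z => g z.2 z.1) -> (forall y, mpres m1 (g y)) ->
  mpres (m1 \x m2)%E (fun z => (g z.2 z.1, z.2)).
Proof.
move=> mg gP.
have mf : measurable_fun setT (fun z : T1 * T2 => (g z.2 z.1, z.2)).
  by apply: measurable_fun_pair => //; exact: measurable_snd.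
split => // A mA.
have mfA : measurable ((fun z => (g z.2 z.1, z.2)) @^-1` A).
  by rewrite -[X in measurable X]setTI; exact: mf.
rewrite !product_measure12//.
rewrite /product_measure2; apply: eq_integral => y _ /=.
rewrite -[RHS](proj2 (gP y)); last exact: measurable_ysection.
by congr (m1 _); rewrite !ysectionE.
Qed.

End measure_preserving.

(** * Translation invariance of Lebesgue measure *)

Section translation.
Variable R : realType.

(** By uniqueness of Lebesgue measure, it is enough to compare the pushforward with it on half-open
    intervals. *)
Lemma mpres_lebesgue_add (c : R) :
  mpres (@lebesgue_measure R) (fun x => x + c : measurableTypeR R).
Proof.
have mf : measurable_fun [set: measurableTypeR R] (fun x => x + c : measurableTypeR R).
  by apply: measurable_funD => //; exact: measurable_id.
split => // A mA.
pose mu' : {measure set (measurableTypeR R) -> \bar R} :=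
  measure_function_pushforward__canonical__measure_function_Measure lebesgue_measure mf.
suff -> : lebesgue_measure A = mu' A by [].
apply: lebesgue_measure_unique => // X.
case/ocitvP => [->|[[a b] /= ab ->]]; first by rewrite !measure0.
rewrite /mu' /= /pushforward.
rewrite (_ : _ @^-1` _ = `]a - c, b - c]%classic); last first.
  by apply/seteqP; split => x /=; rewrite !in_itv /= ltrBlDr lerBrDr.
by rewrite !lebesgue_measure_itv /= !lte_fin ltrD2r; case: ifP => // _; rewrite -!EFinD opprD addrACA subrr addr0.
Qed.

Definition tadd n (w x : Rn R n) : Rn R n := [tuple (tnth x i : R) + tnth w i | i < n].

Lemma measurable_tadd n (w : Rn R n) : measurable_fun setT (tadd w).
Proof.
apply/measurable_fun_tnthP => i.
rewrite (_ : _ \o _ = (fun x : Rn R n => (tnth x i : R) + tnth w i)).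
  by apply: measurable_funD => //; exact: measurable_tnth.
by apply/funext => x /=; rewrite tnth_mktuple.
Qed.

Lemma tadd_tcons n (w : Rn R n.+1) z :
  tadd w (tcons z) = tcons (z.1 + thead w, tadd [tuple of behead w] z.2).
Proof.
apply: eq_from_tnth => i; rewrite tnth_mktuple.
case: (unliftP ord0 i) => [j ->|->].
  rewrite /tcons !tnthS tnth_mktuple /= tnth_behead; congr (_ + tnth _ _).
  by apply: val_inj => /=; rewrite inordK /bump ?add1n ?ltnS.
by [].
Qed.

Lemma mpres_leb_add n (w : Rn R n) : mpres (leb R n) (tadd w).
Proof.
split; first exact: measurable_tadd.
elim: n w => [|n IH] w A mA.
  by rewrite /preimage (_ : [set t | A (tadd w t)] = A)//; apply/seteqP; split=> t /=;
     rewrite (tuple0 (tadd w t)) (tuple0 t).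
rewrite /= /cons_measure.
set B := tcons (n:=n) @^-1` A.
have mB : measurable B by rewrite -[X in measurable X]setTI; exact: measurable_tcons.
(* In head and tail coordinates the translation is a composite of two fibre translations. *)
have -> : (tcons (n:=n) @^-1` (tadd w @^-1` A)) =
  ((fun z => (z.1 + thead w, z.2)) \o (fun z => (z.1, tadd [tuple of behead w] z.2))) @^-1` B.
  by apply/seteqP; split => z; rewrite /B /= tadd_tcons.
have [_ ->//] : mpres (@lebesgue_measure R \x leb R n)%E
   ((fun z : measurableTypeR R * Rn R n => (z.1 + thead w : measurableTypeR R, z.2)) \o (fun z => (z.1, tadd [tuple of behead w] z.2))).
apply: mpres_comp.
  apply: (@mpres_fstfib _ _ _ _ R (@lebesgue_measure R) (leb R n) (fun _ x => x + thead w : measurableTypeR R)).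
    by apply: measurable_funD => //; exact: measurable_fst.
  by move=> _; exact: mpres_lebesgue_add.
apply: (@mpres_sndfib _ _ _ _ R (@lebesgue_measure R) (leb R n) (fun _ => tadd [tuple of behead w])).
  by apply: measurableT_comp; [exact: measurable_tadd|exact: measurable_snd].
by move=> _; split; [exact: measurable_tadd|exact: IH].
Qed.

End translation.

(** * Unitary maps of C^n built from shears *)

Section rotation.
Variables (R : realType) (n : nat).
Implicit Types (z : Cn R n) (u v w : 'I_n) (c s t : R).

Definition single u (a : R) : Rn R n := [tuple if i == u then a else 0 | i < n].

Definition shear1 u v t z : Cn R n := (tadd (single u (t * tnth z.2 v)) z.1, z.2).

Definition shear2 u v t z : Cn R n := (z.1, tadd (single v (t * tnth z.1 u)) z.2).

Let measurable_shear (x y : Cn R n -> Rn R n) u v t :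
  measurable_fun setT x -> measurable_fun setT y ->
  measurable_fun setT (fun z => tadd (single u (t * tnth (y z) v)) (x z)).
Proof.
move=> mx my; apply/measurable_fun_tnthP => i.
rewrite (_ : _ \o _ = (fun z : Cn R n => (tnth (x z) i : R) +
    if i == u then t * tnth (y z) v else 0)); last first.
  by apply/funext => z /=; rewrite !tnth_mktuple.
have mt (f : Cn R n -> Rn R n) j : measurable_fun setT f -> measurable_fun setT (fun z => tnth (f z) j : R).
  by move=> mf; apply: (@measurableT_comp _ _ _ _ _ _ (fun x => tnth x j)) => //; exact: measurable_tnth.
apply: measurable_funD; first exact: mt.
case: (i == u); last exact: measurable_cst.
by apply: measurable_funM; [exact: measurable_cst|exact: mt].
Qed.

Lemma mpres_shear1 u v t : mpres (dV R n) (shear1 u v t).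
Proof.
apply: (@mpres_fstfib _ _ _ _ R (leb R n) (leb R n)
  (fun y => tadd (single u (t * tnth y v)))); last by move=> y; exact: mpres_leb_add.
by apply: measurable_shear; [exact: measurable_fst|exact: measurable_snd].
Qed.

Lemma mpres_shear2 u v t : mpres (dV R n) (shear2 u v t).
Proof.
apply: (@mpres_sndfib _ _ _ _ R (leb R n) (leb R n)
  (fun x => tadd (single v (t * tnth x u)))); last by move=> y; exact: mpres_leb_add.
by apply: measurable_shear; [exact: measurable_snd|exact: measurable_fst].
Qed.

(** It rotates the real plane with coordinates Re z_u and Im z_v. For u = v this is the torus action
    z_u -> (c + i s) z_u; for u != v it is one of the two factors of [mix]. *)
Definition plane_rot u v c s z : Cn R n :=
  ([tuple if i == u then c * tnth z.1 u - s * tnth z.2 v else tnth z.1 i | i < n],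
   [tuple if i == v then s * tnth z.1 u + c * tnth z.2 v else tnth z.2 i | i < n]).

(* A plane rotation is a product of three shears, with parameter tan(theta/2) =
   s / (1 + c) for the outer two; each is a translation in the fibres. *)
Lemma mpres_rot u v c s : c ^+ 2 + s ^+ 2 = 1 -> c != -1 ->
  mpres (dV R n) (plane_rot u v c s).
Proof.
move=> cs c1; have c10 : 1 + c != 0 by rewrite addrC addr_eq0.
have -> : plane_rot u v c s =
  shear1 u v (- (s / (1 + c))) \o (shear2 u v s \o shear1 u v (- (s / (1 + c)))).
  apply/funext => -[x y]; rewrite /plane_rot /shear1 /shear2 /=.
  (* Half-angle identity sin(theta) tan(theta/2) = 1 - cos(theta). *)
  have e : s * (s / (1 + c)) = 1 - c.
    apply: (mulIf c10); rewrite mulrA divfK//.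
    have -> : s * s = 1 - c ^+ 2 by rewrite -cs; ring.
    by ring.
  congr (_, _); apply: eq_from_tnth => i; rewrite !tnth_mktuple !eqxx.
    case: eqP => [->|_]; last by rewrite !addr0.
    set T := s / (1 + c) in e *.
    set X : R := tnth x u; set Y : R := tnth y v.
    have eT : T * (1 + c) = s by rewrite /T divfK.
    have e2 : s * Y = (2 * T - s * T * T) * Y.
      by congr (_ * _); rewrite e -[LHS]eT; ring.
    have ec : c = 1 - s * T by rewrite e opprB addrC subrK.
    by rewrite e2 ec; ring.
  case: eqP => [->|_]; last by rewrite addr0.
  set X : R := tnth x u; set Y : R := tnth y v.
  have ec : c * Y = (1 - s * (s / (1 + c))) * Y by rewrite e opprB addrC subrK.
  by rewrite ec; ring.
apply: mpres_comp; first exact: mpres_shear1.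
by apply: mpres_comp; [exact: mpres_shear2|exact: mpres_shear1].
Qed.

Lemma zcoord_rot_diag u c s z w :
  zcoord (plane_rot u u c s z) w = if w == u then (c +i* s)%C * zcoord z w else zcoord z w.
Proof.
rewrite /zcoord /plane_rot /= !tnth_mktuple; case: eqP => [->|//].
by apply/eqP; rewrite eq_complex /= eqxx addrC eqxx.
Qed.

(* The unitary (z_u, z_v) -> (c z_u + i s z_v, i s z_u + c z_v). Unlike a real
   rotation, it only mixes real parts with imaginary parts, so that it is a
   product of rotations [plane_rot]. *)
Definition mix u v c s z := plane_rot u v c s (plane_rot v u c s z).

Lemma mpres_mix u v c s : c ^+ 2 + s ^+ 2 = 1 -> c != -1 ->
  mpres (dV R n) (mix u v c s).
Proof. by move=> cs c1; apply: mpres_comp; exact: mpres_rot. Qed.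

Lemma zcoord_mix u v c s z w : u != v ->
  zcoord (mix u v c s z) w =
    if w == u then (c%:C * zcoord z u + (0 +i* s) * zcoord z v)%C
    else if w == v then ((0 +i* s) * zcoord z u + c%:C * zcoord z v)%C
    else zcoord z w.
Proof.
move=> uv; have vu : (v == u) = false by rewrite eq_sym (negbTE uv).
rewrite /zcoord /mix /plane_rot /= !tnth_mktuple.
case: (eqVneq w u) => [->|wu]; rewrite ?(negbTE uv) ?vu ?eqxx.
  by apply/eqP; rewrite eq_complex /=; apply/andP; split; apply/eqP; ring.
case: (eqVneq w v) => [_|_]; rewrite ?(negbTE uv) ?vu ?eqxx.
  by apply/eqP; rewrite eq_complex /=; apply/andP; split; apply/eqP; ring.
by [].
Qed.

Lemma zcoord_inj z z' : (forall w, zcoord z w = zcoord z' w) -> z = z'.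
Proof.
case: z z' => [x y] [x' y'] zz'; congr (_, _); apply: eq_from_tnth => i.
  by have [] := zz' i.
by have [] := zz' i.
Qed.

(** The inverse is the adjoint, which only changes the sign of s; as c is kept, so is the condition
    c != -1 under which [mix] preserves [dV]. *)
Lemma mixK u v c s : u != v -> c ^+ 2 + s ^+ 2 = 1 ->
  cancel (mix u v c s) (mix u v c (- s)).
Proof.
move=> uv cs z; apply: zcoord_inj => w; rewrite !zcoord_mix//.
have vu : (v == u) = false by rewrite eq_sym (negbTE uv).
have cs1 : (c%:C * c%:C - (0 +i* s) * (0 +i* s) = 1 :> R[i])%C.
  by apply/eqP; rewrite eq_complex /=; apply/andP; split; apply/eqP; rewrite -?cs; ring.
have sN : ((0 +i* (- s)) = - (0 +i* s) :> R[i])%C.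
  by apply/eqP; rewrite eq_complex /= oppr0 !eqxx.
rewrite sN !eqxx vu.
case: (eqVneq w u) => [->|_]; first by rewrite -[RHS]mul1r -cs1; ring.
case: (eqVneq w v) => [->|_]; first by rewrite -[RHS]mul1r -cs1; ring.
by [].
Qed.

End rotation.

(** * Integrability of the Bergman weight *)

Section boxes.
Variables (R : realType).

Definition box n (a b : R) : set (Rn R n) :=
  [set x | forall i, a <= (tnth x i : R) <= b].

Arguments box n a b : clear implicits.

Lemma measurable_box n a b : measurable (box n a b).
Proof.
rewrite (_ : box n a b = \bigcap_(i in [set: 'I_n]) ((fun x => tnth x i) @^-1` `[a, b]%classic)).
  apply: fin_bigcap_measurable => [|i _]; first exact: finite_finset.
  by rewrite -[X in measurable X]setTI; apply: measurable_tnth => //; exact: measurable_itv.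
apply/seteqP; split => [x xb i _ /=|x xb i]; first by rewrite in_itv /=; exact: xb.
by have := xb i I; rewrite /= in_itv.
Qed.

Lemma leb_box n (a b : R) : a <= b -> leb R n (box n a b) = ((b - a) ^+ n)%:E.
Proof.
move=> ab; elim: n => [|n IH].
  by rewrite /= diracE expr0 mem_set// => -[].
rewrite /= /cons_measure (_ : _ @^-1` _ = `[a, b]%classic `*` box n a b).
  rewrite product_measure1E//; last exact: measurable_box.
  transitivity (lebesgue_measure `[a, b]%classic * leb R n (box n a b))%E => //.
  rewrite IH lebesgue_measure_itv /= lte_fin.
  move: ab; rewrite le_eqVlt => /predU1P[->|ab]; first by rewrite ltxx mul0e subrr exprS mul0r.
  by rewrite ab -EFinD -EFinM exprS.
apply/seteqP; split => [[x y] /= xy|[x y] /= [xb yb] i].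
  split => [|i]; first by have := xy ord0; rewrite in_itv /= /tcons tnth0.
  by have := xy (lift ord0 i); rewrite /tcons tnthS.
case: (unliftP ord0 i) => [j ->|->]; first by rewrite /tcons tnthS; exact: yb.
by rewrite /tcons tnth0; move: xb; rewrite in_itv.
Qed.

Definition cbox n a b : set (Cn R n) := box n a b `*` box n a b.

Arguments cbox n a b : clear implicits.

Lemma measurable_cbox n a b : measurable (cbox n a b).
Proof. by apply: measurableX; exact: measurable_box. Qed.

Lemma dV_cbox n (a b : R) : a <= b -> dV R n (cbox n a b) = ((b - a) ^+ (n + n))%:E.
Proof.
move=> ab; rewrite /dV /= product_measure1E; [|exact: measurable_box..].
by transitivity (leb R n (box n a b) * leb R n (box n a b))%E => //; rewrite leb_box// exprD EFinM.
Qed.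

End boxes.

Arguments box {R} n a b.
Arguments cbox {R} n a b.

Section density.
Variables (R : realType) (n : nat).
Implicit Types (z : Cn R n).

Definition normsq z : R := \sum_(i < n) ((tnth z.1 i : R) ^+ 2 + (tnth z.2 i : R) ^+ 2).

Lemma normsqE z : enorm (moduli z) ^+ 2 = normsq z.
Proof.
rewrite sqr_sqrtr; last by apply: sumr_ge0 => i _; exact: sqr_ge0.
apply: eq_bigr => i _; rewrite tnth_mktuple /zcoord /=.
by rewrite sqr_sqrtr// addr_ge0// sqr_ge0.
Qed.

Lemma normsq_ge0 z : 0 <= normsq z.
Proof. by apply: sumr_ge0 => i _; rewrite addr_ge0 ?sqr_ge0. Qed.

Lemma normc_zcoord z i : ComplexField.Normc.normc (zcoord z i) ^+ 2 <= normsq z.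
Proof.
rewrite /normsq (bigD1 i)//= /zcoord /= sqr_sqrtr ?addr_ge0 ?sqr_ge0//.
by rewrite lerDl sumr_ge0// => j _; rewrite addr_ge0 ?sqr_ge0.
Qed.

Lemma measurable_coord1 i : measurable_fun setT (fun z => tnth z.1 i : R).
Proof.
apply: (@measurableT_comp _ _ _ _ _ _ (fun x : Rn R n => tnth x i)).
  exact: measurable_tnth.
exact: measurable_fst.
Qed.

Lemma measurable_coord2 i : measurable_fun setT (fun z => tnth z.2 i : R).
Proof.
apply: (@measurableT_comp _ _ _ _ _ _ (fun x : Rn R n => tnth x i)).
  exact: measurable_tnth.
exact: measurable_snd.
Qed.

Lemma measurable_normsq : measurable_fun setT normsq.
Proof.
apply: measurable_sum => i; apply: measurable_funD; apply: measurable_funX.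
  exact: measurable_coord1.
exact: measurable_coord2.
Qed.

Lemma measurable_powr_normsq k : measurable_fun setT (fun z => (1 + normsq z) ^- k).
Proof.
rewrite (_ : (fun z => _) = (fun z => (1 + normsq z) `^ (- k%:R))).
  apply: (measurableT_comp (measurable_powR _)).
  by apply: measurable_funD => //; exact: measurable_normsq.
apply/funext => z; rewrite powRN powR_mulrn//.
by rewrite addr_ge0// normsq_ge0.
Qed.

(* The cubes [-2^k, 2^k]^(2n) cover C^n; on the k-th one minus the previous one
   the integrand is at most 4^((1-k)(n+1)), while the volume is 2^(2n(k+1)). *)
Lemma integral_decay_lty :
  (\int[dV R n]_z ((1 + normsq z) ^- n.+1)%:E < +oo)%E.
Proof.
(* The k-th term has integral 4^(n+1) 4^n / 4^k, at most C / 2^(k+1): the factor 2 makes up for the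
   exponent k+1 in the geometric series of [epsilon_trick0]. *)
pose C : R := 2 * 4 ^+ n.+1 * 4 ^+ n.
pose F k z : \bar R := ((4 ^+ n.+1 / (4 ^+ k) ^+ n.+1) * \1_(cbox n (- 2 ^+ k) (2 ^+ k)) z)%:E.
have F0 k z : (0 <= F k z)%E.
  by rewrite lee_fin mulr_ge0// divr_ge0// exprn_ge0// exprn_ge0.
have mF k : measurable_fun setT (F k).
  apply/measurable_EFinP; apply: measurable_funM => //.
  by apply: measurable_indic; exact: measurable_cbox.
apply: (@le_lt_trans _ _ (\int[dV R n]_z \sum_(k <oo) F k z)%E).
  apply: ge0_le_integral => //.
  - by move=> z _; rewrite lee_fin invr_ge0 exprn_ge0// addr_ge0// normsq_ge0.
  - by apply/measurable_EFinP; exact: measurable_powr_normsq.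
  - by apply: (@ge0_emeasurable_sum _ _ _ setT F xpredT) => // k _.
  - move=> z _.
    have coordle i : `|tnth z.1 i : R| ^+ 2 <= normsq z /\ `|tnth z.2 i : R| ^+ 2 <= normsq z.
      have zi := normc_zcoord z i.
      rewrite !real_normK ?num_real//; split; apply: le_trans zi;
        by rewrite /zcoord /= sqr_sqrtr ?addr_ge0 ?sqr_ge0// ?lerDl ?lerDr sqr_ge0.
    have inbox (r : R) : 0 <= r -> normsq z <= r ^+ 2 -> cbox n (- r) r z.
      move=> r0 zr; split => i; rewrite -ler_norml -(@ler_pXn2r _ 2) ?nnegrE//.
        exact: le_trans (proj1 (coordle i)) zr.
      exact: le_trans (proj2 (coordle i)) zr.
    have ex : exists k, `[< cbox n (- 2 ^+ k) (2 ^+ k) z >].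
      exists (Num.truncn (normsq z)).+1; apply/asboolP/inbox; first exact: exprn_ge0.
      set N := (Num.truncn _).+1.
      have zN : normsq z <= N%:R by rewrite ltW// real_truncnS_gt ?num_real.
      apply: le_trans zN _; rewrite -exprM mulnC exprM -natrX -natrX ler_nat.
      by rewrite ltnW// (leq_trans (ltn_expl N (isT : (1 < 4)%N))).
    have [/= k /asboolP zk kmin] := ex_minnP ex.
    apply: (@le_trans _ _ (F k z)); last first.
      by rewrite (@nneseriesD1 _ (F ^~ z) k xpredT)// leeDl// nneseries_ge0.
    rewrite lee_fin indicE mem_set// mulr1.
    (* By minimality z is outside the previous cube, hence |z|^2 > 4^(k-1). For k = 0 there is no
       previous cube and the summand 1 suffices. *)
    have k4 : 4 ^+ k <= 4 * (1 + normsq z).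
      case: k zk kmin => [_ _|k zk kmin]; first by rewrite expr0; have := normsq_ge0 z; lra.
      rewrite exprS ler_pM2l//; apply: contrapT => /negP; rewrite -ltNge => qk.
      suff /asboolT/kmin : cbox n (- 2 ^+ k) (2 ^+ k) z by rewrite ltnn.
      apply: inbox; first exact: exprn_ge0.
      rewrite -exprM mulnC exprM (_ : 2 ^+ 2 = 4 :> R); last by rewrite -natrX.
      by apply: ltW; apply: lt_trans qk; rewrite ltrDr.
    rewrite -[leRHS]expr_div_n -[leLHS]exprVn ler_pXn2r// ?nnegrE ?invr_ge0 ?divr_ge0 ?exprn_ge0 ?addr_ge0 ?normsq_ge0//.
    rewrite -[leRHS]invf_div lef_pV2 ?posrE ?divr_gt0 ?exprn_gt0 ?ltr_wpDr ?normsq_ge0//.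
    by rewrite ler_pdivrMr// mulrC.
rewrite integral_nneseries//.
apply: (@le_lt_trans _ _ (C%:E)); last exact: ltry.
apply: le_trans (@epsilon_trick0 R C xpredT _); last by rewrite /C !mulr_ge0.
apply: lee_nneseries => [k _ _|k _]; first exact: integral_ge0.
rewrite (@integralZl_indic _ _ _ _ _ _ (fun=> cbox n (- 2 ^+ k) (2 ^+ k)))//; [|by rewrite ltNge divr_ge0 ?exprn_ge0|exact: measurable_cbox].
rewrite integral_indic//; last exact: measurable_cbox.
rewrite setIT dV_cbox; last by rewrite ge0_cp ?exprn_ge0.
rewrite -EFinM lee_fin opprK.
rewrite (_ : 2 ^+ k + 2 ^+ k = 2 * 2 ^+ k :> R); last by ring.
rewrite exprD -exprMn (_ : 2 * 2 ^+ k * (2 * 2 ^+ k) = 4 * 4 ^+ k :> R); last first.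
  rewrite (_ : 4 = 2 * 2 :> R); last by ring.
  by rewrite exprMn; ring.
rewrite exprMn natrX /C; move: (4 ^+ n.+1) (exprn_ge0 n.+1 (ler0n R 4)) => A A0.
have B0 : 0 <= 4 ^+ n :> R by exact: exprn_ge0.
have P0 : 4 ^+ k != 0 :> R by rewrite expf_neq0.
have Q0 : 2 ^+ k != 0 :> R by rewrite expf_neq0.
rewrite [X in _ <= X](_ : _ = A * 4 ^+ n * (2 ^+ k)^-1); last first.
  by rewrite [2 ^+ k.+1]exprS; field.
rewrite [X in X <= _](_ : _ = A * 4 ^+ n * (4 ^+ k)^-1); last first.
  have : (4 ^+ k) ^+ n != 0 :> R by rewrite expf_neq0.
  rewrite [_ ^+ n.+1]exprS; move: ((4 ^+ k : R) ^+ n) (4 ^+ k : R) P0 (4 ^+ n : R) => X P P0 B X0.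
  by field; apply/andP.
apply: ler_wpM2l; first exact: mulr_ge0.
by rewrite lef_pV2 ?posrE ?exprn_gt0// lerXn2r ?nnegrE// ler_nat.
Qed.

End density.

(** * Complex-valued integrals *)

Section complex_modulus.
Variable R : realType.
Implicit Types x y : R[i].

Lemma normc_ge0 x : 0 <= normc x.
Proof. by case: x => a b; exact: sqrtr_ge0. Qed.

Lemma normc_conjc x : normc (conjc x) = normc x.
Proof. by case: x => a b; rewrite /normc /= sqrrN. Qed.

Lemma normc_real (r : R) : normc r%:C%C = `|r|.
Proof. by rewrite /normc /= expr0n addr0 sqrtr_sqr. Qed.

Lemma ler_norm_Re_normc x : `|Re x| <= normc x.
Proof. by case: x => a b /=; rewrite -sqrtr_sqr ler_sqrt ?addr_ge0 ?sqr_ge0// lerDl sqr_ge0. Qed.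

Lemma ler_norm_Im_normc x : `|Im x| <= normc x.
Proof. by case: x => a b /=; rewrite -sqrtr_sqr ler_sqrt ?addr_ge0 ?sqr_ge0// lerDr sqr_ge0. Qed.

Lemma normcX x k : normc (x ^+ k) = normc x ^+ k.
Proof.
elim: k => [|k IH]; first by rewrite !expr0 ComplexField.Normc.normc1.
by rewrite !exprS ComplexField.Normc.normcM IH.
Qed.

Lemma normc_prod (I : Type) (s : seq I) (F : I -> R[i]) :
  normc (\prod_(i <- s) F i) = \prod_(i <- s) normc (F i).
Proof.
elim: s => [|i s IH]; first by rewrite !big_nil ComplexField.Normc.normc1.
by rewrite !big_cons ComplexField.Normc.normcM IH.
Qed.

Lemma cReM x y : Re (x * y) = Re x * Re y - Im x * Im y.
Proof. by case: x y => [a b] [c d]. Qed.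

Lemma cImM x y : Im (x * y) = Re x * Im y + Im x * Re y.
Proof. by case: x y => [a b] [c d]. Qed.

Lemma cReD x y : Re (x + y) = Re x + Re y.
Proof. by case: x y => [a b] [c d]. Qed.

Lemma cImD x y : Im (x + y) = Im x + Im y.
Proof. by case: x y => [a b] [c d]. Qed.

End complex_modulus.

Section complex_measurable.
Context d (T : measurableType d) (R : realType).
Implicit Types f g : T -> R[i].

Definition cmeasurable f :=
  measurable_fun setT (fun x => Re (f x)) /\ measurable_fun setT (fun x => Im (f x)).

Lemma cmeasurable_cst c : cmeasurable (fun=> c).
Proof. by split; exact: measurable_cst. Qed.

Lemma cmeasurableD f g : cmeasurable f -> cmeasurable g ->
  cmeasurable (fun x => f x + g x).
Proof.
move=> [f1 f2] [g1 g2]; split.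
  by under eq_fun do rewrite cReD; exact: measurable_funD.
by under eq_fun do rewrite cImD; exact: measurable_funD.
Qed.

Lemma cmeasurableM f g : cmeasurable f -> cmeasurable g ->
  cmeasurable (fun x => f x * g x).
Proof.
move=> [f1 f2] [g1 g2]; split.
  by under eq_fun do rewrite cReM; apply: measurable_funB; exact: measurable_funM.
by under eq_fun do rewrite cImM; apply: measurable_funD; exact: measurable_funM.
Qed.

Lemma cmeasurable_conjc f : cmeasurable f -> cmeasurable (fun x => conjc (f x)).
Proof.
move=> [f1 f2]; split.
  by rewrite (_ : (fun x => _) = (fun x => Re (f x)))//; apply/funext => x; case: (f x).
rewrite (_ : (fun x => _) = (fun x => - Im (f x))); first exact: measurable_funN.
by apply/funext => x; case: (f x).
Qed.

Lemma cmeasurable_real (h : T -> R) : measurable_fun setT h ->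
  cmeasurable (fun x => (h x)%:C%C).
Proof. by move=> mh; split => //; exact: measurable_cst. Qed.

Lemma cmeasurableX f k : cmeasurable f -> cmeasurable (fun x => f x ^+ k).
Proof.
move=> mf; elim: k => [|k IH]; first exact: cmeasurable_cst.
by under eq_fun do rewrite exprS; exact: cmeasurableM.
Qed.

Lemma cmeasurable_prod (I : Type) (s : seq I) (F : I -> T -> R[i]) :
  (forall i, cmeasurable (F i)) -> cmeasurable (fun x => \prod_(i <- s) F i x).
Proof.
move=> mF; elim: s => [|i s IH].
  by under eq_fun do rewrite big_nil; exact: cmeasurable_cst.
by under eq_fun do rewrite big_cons; exact: cmeasurableM.
Qed.

Lemma cmeasurable_comp f (h : T -> T) : cmeasurable f -> measurable_fun setT h ->
  cmeasurable (f \o h).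
Proof. by move=> [f1 f2] mh; split; [exact: (measurableT_comp f1)|exact: (measurableT_comp f2)]. Qed.

End complex_measurable.

Section complex_integral.
Context d (T : measurableType d) (R : realType) (mu : {measure set T -> \bar R}).
Implicit Types f g : T -> R[i].

Definition cintegrable f :=
  mu.-integrable setT (EFin \o (fun x => Re (f x))) /\
  mu.-integrable setT (EFin \o (fun x => Im (f x))).

Lemma cintegrable_le f (h : T -> R) : cmeasurable f ->
  mu.-integrable setT (EFin \o h) -> (\forall x \ae mu, normc (f x) <= h x) ->
  cintegrable f.
Proof.
move=> mf ih fh; have [mh _] := integrableP _ _ _ ih; have [f1 f2] := mf.
have key (k : T -> R) : measurable_fun setT k ->
    (forall x, `|k x| <= normc (f x)) -> mu.-integrable setT (EFin \o k).
  move=> mk kf; apply/integrableP; split; first exact/measurable_EFinP.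
  move/integrableP : ih => [_]; apply: le_lt_trans.
  apply: ae_ge0_le_integral => //.
  - by apply: measurableT_comp => //; exact/measurable_EFinP.
  - by apply: measurableT_comp.
  - apply: filterS fh => x fhx _ /=.
    rewrite lee_fin; apply: le_trans (kf x) _; apply: le_trans fhx _.
    exact: ler_norm.
by split; apply: key => // x; [exact: ler_norm_Re_normc|exact: ler_norm_Im_normc].
Qed.

Lemma cintegralD f g : cintegrable f -> cintegrable g ->
  cintegral mu (fun x => f x + g x) = cintegral mu f + cintegral mu g.
Proof.
move=> [f1 f2] [g1 g2]; rewrite /cintegral.
under eq_Rintegral do rewrite cReD.
under [X in (_ +i* X)%C = _]eq_Rintegral do rewrite cImD.
by rewrite !RintegralD//.
Qed.

Lemma cintegralZ c f : cintegrable f ->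
  cintegral mu (fun x => c * f x) = c * cintegral mu f.
Proof.
move=> [f1 f2]; rewrite /cintegral.
have iZ (r : R) (k : T -> R) : mu.-integrable setT (EFin \o k) ->
    mu.-integrable setT (EFin \o (fun x => r * k x)).
  by move=> ik; have := integrableZl measurableT r ik; apply: eq_integrable.
under eq_Rintegral do rewrite cReM.
under [X in (_ +i* X)%C = _]eq_Rintegral do rewrite cImM.
rewrite RintegralB ?RintegralD ?RintegralZl//; do ?exact: iZ.
by case: c.
Qed.

Lemma cintegral_ae f g : cmeasurable f -> cmeasurable g ->
  (\forall x \ae mu, f x = g x) -> cintegral mu f = cintegral mu g.
Proof.
move=> [f1 f2] [g1 g2] fg; rewrite /cintegral /Rintegral.
by congr (fine _ +i* fine _)%C; apply: ae_eq_integral => //;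
  try exact/measurable_EFinP; apply: filterS fg => x -> _.
Qed.

Lemma cintegral_mpres f h : mpres mu h -> cmeasurable f ->
  cintegral mu (fun x => f (h x)) = cintegral mu f.
Proof.
move=> hP [f1 f2]; rewrite /cintegral /Rintegral.
by congr (fine _ +i* fine _)%C;
  [apply: (integral_mpres (g := EFin \o (fun x => Re (f x))) hP)|
   apply: (integral_mpres (g := EFin \o (fun x => Im (f x))) hP)];
  exact/measurable_EFinP.
Qed.

End complex_integral.

(** * The inner product *)

Section growth.
Variables (R : realType) (n m : nat).
Implicit Types (z : Cn R n) (F G H phi : Cn R n -> R[i]) (a b : 'I_n -> nat).

Definition weight z : R := Num.sqrt (1 + normsq z).

Lemma weight_ge1 z : 1 <= weight z.
Proof. by rewrite -[leLHS]sqrtr1 ler_sqrt ?lerDl ?normsq_ge0// addr_ge0 ?normsq_ge0. Qed.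

(** The growth of polynomials of degree at most m, up to null sets. Unlike P_m, this class is stable
    under bounded symbols, and it still makes all the pairings below integrable. *)
Definition growth F := cmeasurable F /\
  exists K : R, \forall z \ae dV R n, normc (F z) <= K * weight z ^+ m.

Definition bounded phi := cmeasurable phi /\
  exists K : R, \forall z \ae dV R n, normc (phi z) <= K.

Definition mon a z : R[i] := \prod_(i < n) zcoord z i ^+ a i.

Lemma growthD F G : growth F -> growth G -> growth (fun z => F z + G z).
Proof.
move=> [mF [K FK]] [mG [L GL]]; split; first exact: cmeasurableD.
exists (K + L); apply: filterS2 FK GL => z FK GL.
by rewrite mulrDl; apply: le_trans (le_normcD _ _) _; exact: lerD.
Qed.

Lemma growthZ c F : growth F -> growth (fun z => c * F z).
Proof.
move=> [mF [K FK]]; split; first by apply: cmeasurableM => //; exact: cmeasurable_cst.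
exists (normc c * K); apply: filterS FK => z FK.
by rewrite ComplexField.Normc.normcM -mulrA ler_wpM2l ?normc_ge0.
Qed.

Lemma growth0 : growth (fun=> 0).
Proof.
split; first exact: cmeasurable_cst.
by exists 0; apply: aeW => z; rewrite mul0r ComplexField.Normc.normc0.
Qed.

Lemma growth_sum (I : Type) (s : seq I) (P : pred I) (F : I -> Cn R n -> R[i]) :
  (forall i, P i -> growth (F i)) -> growth (fun z => \sum_(i <- s | P i) F i z).
Proof.
move=> gF; elim: s => [|i s IH].
  by under eq_fun do rewrite big_nil; exact: growth0.
under eq_fun do rewrite big_cons.
case Pi: (P i) => //.
by apply: growthD => //; exact: gF.
Qed.

Lemma bounded_growthM phi F : bounded phi -> growth F -> growth (fun z => phi z * F z).
Proof.
move=> [mp [M pM]] [mF [K FK]]; split; first exact: cmeasurableM.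
exists (M * K); apply: filterS2 pM FK => z pM FK.
by rewrite ComplexField.Normc.normcM -mulrA; apply: ler_pM => //; exact: normc_ge0.
Qed.

Lemma cmeasurable_zcoord i : cmeasurable (fun z => zcoord z i).
Proof. by split; [exact: measurable_coord1|exact: measurable_coord2]. Qed.

Lemma cmeasurable_mon a : cmeasurable (mon a).
Proof. by apply: cmeasurable_prod => i; apply: cmeasurableX; exact: cmeasurable_zcoord. Qed.

Lemma growth_mon a : (\sum_(i < n) a i <= m)%N -> growth (mon a).
Proof.
move=> am; split; first exact: cmeasurable_mon.
exists 1; apply: aeW => z; rewrite mul1r /mon normc_prod.
apply: (@le_trans _ _ (\prod_(i < n) weight z ^+ a i)).
  apply: ler_prod => i _; rewrite normcX exprn_ge0 ?normc_ge0// andTb.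
  apply: lerXn2r; rewrite ?nnegrE ?normc_ge0 ?sqrtr_ge0//.
  rewrite -(ger0_norm (normc_ge0 _)) -sqrtr_sqr ler_sqrt ?addr_ge0 ?normsq_ge0//.
  by apply: le_trans (normc_zcoord z i) _; rewrite lerDr.
rewrite -expr_sum; apply: ler_weXn2l => //; exact: weight_ge1.
Qed.

Definition mass : R := (n + m)`!%:R / (pi ^+ n * m`!%:R).

Lemma nu_densityE z : nu_density m z = mass * (1 + normsq z) ^- (n + m + 1).
Proof. by rewrite /nu_density normsqE. Qed.

Lemma mass_gt0 : 0 < mass.
Proof. by rewrite divr_gt0 ?mulr_gt0 ?exprn_gt0 ?pi_gt0// ltr0n fact_gt0. Qed.

Lemma nu_density_gt0 z : 0 < nu_density m z.
Proof.
rewrite nu_densityE mulr_gt0 ?mass_gt0// invr_gt0 exprn_gt0//.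
by rewrite ltr_pwDl// normsq_ge0.
Qed.

Lemma measurable_nu_density : measurable_fun setT (@nu_density R n m).
Proof.
have -> : nu_density m = (fun z => mass * (1 + normsq z) ^- (n + m + 1)).
  by apply/funext => z; exact: nu_densityE.
by apply: measurable_funM => //; exact: measurable_powr_normsq.
Qed.

Definition integrand F H z : R[i] := F z * conjc (H z) * (nu_density m z)%:C%C.

Lemma cmeasurable_integrand F H : cmeasurable F -> cmeasurable H ->
  cmeasurable (integrand F H).
Proof.
move=> mF mH; apply: cmeasurableM; first apply: cmeasurableM => //.
  exact: cmeasurable_conjc.
by apply: cmeasurable_real; exact: measurable_nu_density.
Qed.

(** Each factor uses up m/2 powers of 1 + |z|^2, so the density of exponent n + m + 1 leaves exactly
    the exponent n + 1 of [integral_decay_lty]. *)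
Lemma cintegrable_integrand F H : growth F -> growth H ->
  cintegrable (dV R n) (integrand F H).
Proof.
move=> [mF [K FK]] [mH [L HL]].
apply: (@cintegrable_le _ _ _ _ _ (fun z => K * L * mass * (1 + normsq z) ^- n.+1)).
- exact: cmeasurable_integrand.
- have := integral_decay_lty R n => lty.
  apply: (eq_integrable measurableT (fun z => (K * L * mass)%:E * ((1 + normsq z) ^- n.+1)%:E)%E) => //.
  apply: integrableZl => //; apply/integrableP; split.
    by apply/measurable_EFinP; exact: measurable_powr_normsq.
  apply: le_lt_trans lty; apply: ge0_le_integral => //.
  + by apply: measurableT_comp => //; apply/measurable_EFinP; exact: measurable_powr_normsq.
  + by apply/measurable_EFinP; exact: measurable_powr_normsq.
  + by move=> z _; rewrite gee0_abs// lee_fin invr_ge0 exprn_ge0 // addr_ge0// normsq_ge0.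
- apply: filterS2 FK HL => z FK HL.
  rewrite /integrand !ComplexField.Normc.normcM normc_conjc normc_real.
  rewrite ger0_norm; last exact/ltW/nu_density_gt0.
  rewrite nu_densityE.
  have w0 : 0 < 1 + normsq z by rewrite ltr_pwDl// normsq_ge0.
  have -> : (1 + normsq z) ^- n.+1 =
     weight z ^+ m * weight z ^+ m * (1 + normsq z) ^- (n + m + 1).
    rewrite -exprMn -expr2 sqr_sqrtr ?ltW//.
    rewrite addn1 -addSn exprD invfM mulrCA mulfV ?mulr1//.
    by rewrite expf_neq0// gt_eqF.
  rewrite (_ : K * L * mass * _ = (K * weight z ^+ m) * (L * weight z ^+ m) *
    (mass * (1 + normsq z) ^- (n + m + 1))); last by ring.
  apply: ler_wpM2r; first by rewrite ltW// mulr_gt0 ?mass_gt0 ?invr_gt0 ?exprn_gt0.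
  by apply: ler_pM => //; exact: normc_ge0.
Qed.

Lemma innerDl F G H : growth F -> growth G -> growth H ->
  inner m (fun z => F z + G z) H = inner m F H + inner m G H.
Proof.
move=> gF gG gH; rewrite -[RHS](cintegralD (cintegrable_integrand gF gH) (cintegrable_integrand gG gH)).
by congr cintegral; apply/funext => z; rewrite /integrand !mulrDl.
Qed.

Lemma innerZl c F H : growth F -> growth H ->
  inner m (fun z => c * F z) H = c * inner m F H.
Proof.
move=> gF gH; rewrite -[RHS](cintegralZ c (cintegrable_integrand gF gH)).
by congr cintegral; apply/funext => z; rewrite /integrand !mulrA.
Qed.

Lemma innerDr F G H : growth F -> growth G -> growth H ->
  inner m F (fun z => G z + H z) = inner m F G + inner m F H.
Proof.
move=> gF gG gH; rewrite -[RHS](cintegralD (cintegrable_integrand gF gG) (cintegrable_integrand gF gH)).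
by congr cintegral; apply/funext => z; rewrite /integrand rmorphD mulrDr mulrDl.
Qed.

Lemma innerZr c F H : growth F -> growth H ->
  inner m F (fun z => c * H z) = conjc c * inner m F H.
Proof.
move=> gF gH; rewrite -[RHS](cintegralZ (conjc c) (cintegrable_integrand gF gH)).
by congr cintegral; apply/funext => z; rewrite /integrand rmorphM; ring.
Qed.

Lemma inner_suml (I : Type) (s : seq I) (c : I -> R[i]) (F : I -> Cn R n -> R[i]) H :
  (forall i, growth (F i)) -> growth H ->
  inner m (fun z => \sum_(i <- s) c i * F i z) H = \sum_(i <- s) c i * inner m (F i) H.
Proof.
move=> gF gH; elim: s => [|i s IH].
  rewrite big_nil -[RHS](mul0r (inner m (fun=> 0) H)) -innerZl//; last exact: growth0.
  by apply: (congr1 (fun G => inner m G H)); apply/funext => z; rewrite big_nil mul0r.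
rewrite big_cons -IH -innerZl// -innerDl//; last 2 first.
- exact: growthZ.
- by apply: growth_sum => j _; exact: growthZ.
by apply: (congr1 (fun G => inner m G H)); apply/funext => z; rewrite big_cons.
Qed.

Lemma inner_sumr (I : Type) (s : seq I) (c : I -> R[i]) (H : I -> Cn R n -> R[i]) F :
  growth F -> (forall i, growth (H i)) ->
  inner m F (fun z => \sum_(i <- s) c i * H i z) = \sum_(i <- s) conjc (c i) * inner m F (H i).
Proof.
move=> gF gH; elim: s => [|i s IH].
  rewrite big_nil; transitivity (conjc 0 * inner m F (fun=> 0)); last by rewrite conjc0 mul0r.
  rewrite -innerZr//; last exact: growth0.
  by congr (inner _ _ _); apply/funext => z; rewrite big_nil mulr0.
rewrite big_cons -IH -innerZr// -innerDr//; last 2 first.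
- exact: growthZ.
- by apply: growth_sum => j _; exact: growthZ.
by congr (inner _ _ _); apply/funext => z; rewrite big_cons.
Qed.

Lemma inner_ae F F' H : cmeasurable F -> cmeasurable F' -> cmeasurable H ->
  (\forall z \ae dV R n, F z = F' z) -> inner m F H = inner m F' H.
Proof.
move=> mF mF' mH FF'; apply: cintegral_ae; [exact: cmeasurable_integrand..|].
by apply: filterS FF' => z ->.
Qed.

Lemma inner_mpres h F H : mpres (dV R n) h -> (forall z, normsq (h z) = normsq z) ->
  cmeasurable F -> cmeasurable H -> inner m (F \o h) (H \o h) = inner m F H.
Proof.
move=> hP hq mF mH; rewrite -[RHS](cintegral_mpres hP (cmeasurable_integrand mF mH)).
by congr cintegral; apply/funext => z; rewrite /integrand !nu_densityE hq.
Qed.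

(* The integrand is positive on the cube [1, 2]^(2n). *)
Lemma inner_mon_neq0 a : (\sum_(i < n) a i <= m)%N -> inner m (mon a) (mon a) != 0.
Proof.
move=> am; have gm := growth_mon am.
have [i1 _] := cintegrable_integrand gm gm.
pose f z := Re (integrand (mon a) (mon a) z).
have fE z : f z = normc (mon a z) ^+ 2 * nu_density m z.
  rewrite /f /integrand cReM /= mulr0 subr0; case: (mon a z) => x y /=.
  by rewrite sqr_sqrtr ?addr_ge0 ?sqr_ge0//; ring.
have f0 z : 0 <= f z by rewrite fE mulr_ge0 ?sqr_ge0// ltW// nu_density_gt0.
apply/eqP => /(congr1 (@complex.Re R)); rewrite /inner /cintegral /= => I0.
(* [fine] also sends +oo to 0; integrability excludes that case. *)
have {}I0 : (\int[dV R n]_z `|(f z)%:E| = 0)%E.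
  rewrite -[LHS]fineK.
    rewrite -[RHS]/(0%:E); congr EFin; rewrite -[RHS]I0; congr fine.
    by apply: eq_integral => z _; rewrite gee0_abs ?lee_fin.
  rewrite ge0_fin_numE; last by apply: integral_ge0.
  by case/integrableP : i1.
have mf : measurable_fun setT (EFin \o f) by case/integrableP : i1.
have [N [mN N0 fN]] := (proj1 (ae_eq_integral_abs (dV R n) measurableT mf)) I0.
have : (dV R n (cbox n 1 2) <= dV R n N)%E.
  apply: le_measure; rewrite ?inE//; first exact: measurable_cbox.
  move=> z [z1 z2]; apply: fN => /(_ I) /= -[] /eqP; apply/negP.
  rewrite fE mulf_neq0 ?gt_eqF ?nu_density_gt0//.
  rewrite exprn_gt0// /mon normc_prod prodr_gt0// => i _.
  rewrite normcX exprn_gt0// /= sqrtr_gt0.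
  have /andP[x1 _] := z1 i.
  by apply: (@lt_le_trans _ _ 1); rewrite // (le_trans (exprn_ege1 2 x1))// lerDl sqr_ge0.
by rewrite [X in (_ <= X)%E]N0 dV_cbox ?ler1n// lee_fin leNgt exprn_gt0// subr_gt0 ltr1n.
Qed.

End growth.

(** * Matrix elements and torus weights *)

Section torus_root.
Variable R : realType.

(* The root is taken of order 2|k| so that it is not -1, see [torus_type]. *)
Lemma unit_not_root (k : int) : k != 0 ->
  exists c s : R, [/\ c ^+ 2 + s ^+ 2 = 1, c != -1 & (c +i* s)%C ^ k != 1].
Proof.
move=> k0; pose N := (`|k| * 2)%N.
have N0 : (0 < N)%N by rewrite muln_gt0 absz_gt0 k0.
have eN : (N.-root (-1) : R[i]) ^+ N = -1 by exact: rootCK.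
case E : (N.-root (-1) : R[i]) eN => [c s] eN.
have n1 : normc (c +i* s)%C = 1.
  apply/eqP; rewrite -(@pexpr_eq1 _ _ N)//; last exact: normc_ge0.
  rewrite -normcX eN.
  by rewrite /normc /= oppr0 expr0n addr0 sqrrN expr1n sqrtr1.
have cs : c ^+ 2 + s ^+ 2 = 1.
  by rewrite -[LHS]sqr_sqrtr ?addr_ge0 ?sqr_ge0// [Num.sqrt _]n1 expr1n.
have N11 : (-1 : R[i]) != 1 by rewrite eq_sym -subr_eq0 opprK -mulr2n pnatr_eq0.
exists c, s; split => //.
  apply/eqP => c1; move: cs; rewrite c1 sqrrN expr1n => /eqP.
  rewrite -[X in _ == X]addr0 (inj_eq (addrI _)) sqrf_eq0 => /eqP s0.
  move: eN; rewrite c1 s0 (_ : (-1 +i* 0)%C = -1); last first.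
    by apply/eqP; rewrite eq_complex /= oppr0 !eqxx.
  by rewrite /N mulnC exprM sqrrN expr1n expr1n => /esym/eqP; rewrite (negbTE N11).
apply: contra N11 => /eqP ek; rewrite -eN /N exprM.
suff -> : (c +i* s)%C ^+ `|k| = 1 by rewrite expr1n.
(* For negative k the power e^k is the inverse of e^|k|. *)
case: k {N N0 E eN k0} ek => // j ej.
by apply: invr_inj; rewrite invr1 -[RHS]ej.
Qed.

End torus_root.

Section matrix_elements.
Variables (R : realType) (n m : nat).
Implicit Types (z : Cn R n) (phi : Cn R n -> R[i]) (a b : 'I_n -> nat) (p : 'I_n -> int).
Implicit Types (u v : 'I_n).

Lemma eq_sum_pair (P : pred 'I_n) (f g : 'I_n -> R) u v : P u -> P v -> v != u ->
  (forall i, i != u -> i != v -> f i = g i) -> f u + f v = g u + g v ->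
  \sum_(i | P i) f i = \sum_(i | P i) g i.
Proof.
move=> Pu Pv vu fg fguv.
have Pvu : P v && (v != u) by rewrite Pv.
rewrite (bigD1 u Pu) (bigD1 v Pvu) [RHS](bigD1 u Pu) [X in _ = _ + X](bigD1 v Pvu) /=.
rewrite !addrA fguv; congr (_ + _); apply: eq_bigr => i /andP[/andP[_ iu] iv].
exact: fg.
Qed.

Lemma sum_sqr_normc_mix (P : pred 'I_n) u v (c s : R) z :
  u != v -> P u = P v -> c ^+ 2 + s ^+ 2 = 1 ->
  \sum_(i < n | P i) normc (zcoord (mix u v c s z) i) ^+ 2 =
  \sum_(i < n | P i) normc (zcoord z i) ^+ 2.
Proof.
move=> uv Puv cs; have vu : (v == u) = false by rewrite eq_sym (negbTE uv).
case Pu : (P u); last first.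
  apply: eq_bigr => i Pi; rewrite zcoord_mix//.
  by do 2 ?[case: eqP => [iu|_]; first by move: Pi; rewrite iu -?Puv Pu].
apply: (@eq_sum_pair _ _ _ u v); [by []|by rewrite -Puv|by rewrite vu|move=> i iu iv|].
  by rewrite zcoord_mix// (negbTE iu) (negbTE iv).
rewrite !zcoord_mix// vu !eqxx /zcoord /= !sqr_sqrtr ?addr_ge0 ?sqr_ge0//.
move: (tnth z.1 u : R) (tnth z.1 v : R) (tnth z.2 u : R) (tnth z.2 v : R) => x x' y y'.
rewrite -[RHS]mul1r -cs; ring.
Qed.

Lemma normsq_normc z : normsq z = \sum_(i < n) normc (zcoord z i) ^+ 2.
Proof. by apply: eq_bigr => i _; rewrite /zcoord /= sqr_sqrtr// addr_ge0 ?sqr_ge0. Qed.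

Lemma normc_rot u v (c s : R) z : c ^+ 2 + s ^+ 2 = 1 ->
  normc (zcoord (plane_rot u u c s z) v) = normc (zcoord z v).
Proof.
move=> cs; rewrite zcoord_rot_diag; case: eqP => // _.
by rewrite ComplexField.Normc.normcM {1}/normc /= cs sqrtr1 mul1r.
Qed.

Lemma normsq_rot u (c s : R) z : c ^+ 2 + s ^+ 2 = 1 ->
  normsq (plane_rot u u c s z) = normsq z.
Proof. by move=> cs; rewrite !normsq_normc; apply: eq_bigr => i _; rewrite normc_rot. Qed.

Lemma normsq_mix u v (c s : R) z : u != v -> c ^+ 2 + s ^+ 2 = 1 ->
  normsq (mix u v c s z) = normsq z.
Proof. by move=> uv cs; rewrite !normsq_normc sum_sqr_normc_mix. Qed.

(* The case c = -1 is left out because [mpres_rot] does not cover it. *)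
Definition torus_type phi p := forall u (c s : R), c ^+ 2 + s ^+ 2 = 1 -> c != -1 ->
  \forall z \ae dV R n, phi (plane_rot u u c s z) = (c +i* s)%C ^ p u * phi z.

Definition mix_invariant phi u v := forall c s : R, c ^+ 2 + s ^+ 2 = 1 -> c != -1 ->
  \forall z \ae dV R n, phi (mix u v c s z) = phi z.

Definition elt phi a b : R[i] := inner m (fun z => phi z * mon a z) (mon b).

Lemma mon_rot a u (c s : R) z : mon a (plane_rot u u c s z) = (c +i* s)%C ^+ a u * mon a z.
Proof.
rewrite /mon (bigD1 u)//= [X in _ = _ * X](bigD1 u)//= zcoord_rot_diag eqxx exprMn mulrA.
by congr (_ * _); apply: eq_bigr => i iu; rewrite zcoord_rot_diag (negbTE iu).
Qed.

Lemma growth_bounded_mon phi a : bounded phi -> (\sum_(i < n) a i <= m)%N ->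
  growth m (fun z => phi z * mon a z).
Proof. by move=> bp am; apply: bounded_growthM => //; exact: growth_mon. Qed.

(* Rotating z_u by the unit e multiplies the matrix element by e^(a_u + p_u - b_u). *)
Lemma elt_neq0 phi p a b : bounded phi -> torus_type phi p ->
  (\sum_(i < n) a i <= m)%N -> (\sum_(i < n) b i <= m)%N ->
  elt phi a b != 0 -> forall u, (b u)%:Z = (a u)%:Z + p u.
Proof.
move=> bp tp am bm E0 u; apply/eqP; apply: contraNT E0 => ne.
have [c [s [cs c1 ek]]] : exists c s : R, [/\ c ^+ 2 + s ^+ 2 = 1, c != -1 &
    (c +i* s)%C ^ ((a u)%:Z + p u - (b u)%:Z) != 1].
  by apply: unit_not_root; rewrite subr_eq0 eq_sym.
set e := (c +i* s)%C in ek.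
have n1 : normc e = 1 by rewrite /normc /= cs sqrtr1.
have e0 : e != 0 by apply/eqP => e0; move: n1; rewrite e0 ComplexField.Normc.normc0 => /eqP; rewrite eq_sym oner_eq0.
have ce : conjc e = e^-1.
  apply: (mulfI e0); rewrite mulfV//; apply/eqP.
  by rewrite eq_complex /=; apply/andP; split; apply/eqP; [rewrite -cs|]; ring.
have cX k : conjc (e ^+ k) = e^-1 ^+ k by rewrite -ce -[RHS]rmorphXn.
have gm := growth_mon R am; have gb := growth_mon R bm.
have gp := growth_bounded_mon bp am.
have E : elt phi a b = e ^ ((a u)%:Z + p u - (b u)%:Z) * elt phi a b.
  rewrite {1}/elt -(inner_mpres m (mpres_rot u u cs c1))//; last 3 first.
  - by move=> z; exact: normsq_rot.
  - by case: gp.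
  - by case: gb.
  rewrite (@inner_ae _ _ _ _ (fun z => (e ^ p u * e ^+ a u) * (phi z * mon a z))); last first.
  - apply: filterS (tp u c s cs c1) => z /= ->.
    by rewrite mon_rot -/e; ring.
  - by apply: cmeasurable_comp; [case: gb|case: (mpres_rot u u cs c1)].
  - by case: (growthZ (e ^ p u * e ^+ a u) gp).
  - by apply: cmeasurable_comp; [case: gp|case: (mpres_rot u u cs c1)].
  have -> : mon b \o plane_rot u u c s = (fun z => e ^+ b u * mon b z).
    by apply/funext => z /=; rewrite mon_rot.
  rewrite innerZl//; last exact: growthZ.
  rewrite innerZr// cX mulrA; congr (_ * _).
  by rewrite !expfzDr// -exprz_inv [e ^ _ * e ^ p u]mulrC.
apply/eqP; move/eqP: E; rewrite -subr_eq0 -{1}[elt _ _ _]mul1r -mulrBl mulf_eq0.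
by rewrite subr_eq0 eq_sym (negbTE ek) => /eqP.
Qed.

End matrix_elements.

(** * Moving the degree of one coordinate to another *)

Section collapse.
Variables (R : realType) (n m : nat).
Implicit Types (z : Cn R n) (phi : Cn R n -> R[i]) (a b : 'I_n -> nat) (p : 'I_n -> int).
Implicit Types (u v : 'I_n).

Definition upd a u v (x y : nat) : 'I_n -> nat :=
  fun i => if i == u then x else if i == v then y else a i.

Lemma sum_upd a u v x y (P : pred 'I_n) : u != v -> P u -> P v ->
  (x + y = a u + a v)%N -> (\sum_(i | P i) upd a u v x y i = \sum_(i | P i) a i)%N.
Proof.
move=> uv Pu Pv xy; have vu : v != u by rewrite eq_sym.
have Pvu : P v && (v != u) by rewrite Pv.
rewrite (bigD1 u Pu) (bigD1 v Pvu) [RHS](bigD1 u Pu) [X in _ = (_ + X)%N](bigD1 v Pvu) /=.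
rewrite !addnA /upd !eqxx (negbTE vu) xy; congr addn; apply: eq_bigr => i /andP[/andP[_ iu] iv].
by rewrite (negbTE iu) (negbTE iv).
Qed.

(** Representative of the exponents with a given sum a u + a v. Its z_u-exponent is 0, so composing
    its monomial with [mix] produces a single power of a binomial. *)
Definition collapse u v a := upd a u v 0 (a u + a v).

Let rest a u v z : R[i] := \prod_(i < n | (i != u) && (i != v)) zcoord z i ^+ a i.

Let monE a u v z : u != v ->
  mon a z = zcoord z u ^+ a u * (zcoord z v ^+ a v * rest a u v z).
Proof. by move=> uv; rewrite /mon (bigD1 u)//= (bigD1 v)//= eq_sym. Qed.

Let mon_upd a u v x y z : u != v ->
  mon (upd a u v x y) z = zcoord z u ^+ x * (zcoord z v ^+ y * rest a u v z).
Proof.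
move=> uv; rewrite (monE _ _ uv) /upd !eqxx [v == u]eq_sym (negbTE uv).
by do 2 congr (_ * _); apply: eq_bigr => i /andP[/negbTE -> /negbTE ->].
Qed.

Let mon_mix a u v c s z : u != v ->
  mon a (mix u v c s z) =
  (c%:C * zcoord z u + (0 +i* s) * zcoord z v)%C ^+ a u *
  (((0 +i* s) * zcoord z u + c%:C * zcoord z v)%C ^+ a v * rest a u v z).
Proof.
move=> uv; rewrite (monE _ _ uv) !zcoord_mix// !eqxx [v == u]eq_sym (negbTE uv).
by do 2 congr (_ * _); apply: eq_bigr => i /andP[/negbTE iu /negbTE iv]; rewrite zcoord_mix// iu iv.
Qed.

Let mon_collapse_mix a u v (c s : R) z : u != v ->
  mon (collapse u v a) (mix u v c s z) =
  \sum_(i < (a u + a v).+1)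
    ((c%:C ^+ (a u + a v - i) * (0 +i* s) ^+ i *+ 'C(a u + a v, i))%C *
     mon (upd a u v i (a u + a v - i)) z).
Proof.
move=> uv; rewrite mon_mix// /collapse {1 2}/upd eqxx [v == u]eq_sym (negbTE uv) eqxx mul1r.
rewrite addrC exprDn mulr_suml; apply: eq_bigr => i _.
rewrite mon_upd// !exprMn (_ : rest (upd _ _ _ _ _) u v z = rest a u v z); last first.
  by apply: eq_bigr => j /andP[/negbTE ju /negbTE jv]; rewrite /upd ju jv.
by rewrite -!mulrnAl; ring.
Qed.

Let mon_mix_sum b u v (c s : R) z : u != v ->
  mon b (mix u v c s z) =
  \sum_(ij : 'I_(b u).+1 * 'I_(b v).+1)
    ((c%:C ^+ (b u - ij.1) * (0 +i* s) ^+ ij.1 *+ 'C(b u, ij.1) *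
      ((0 +i* s) ^+ (b v - ij.2) * c%:C ^+ ij.2 *+ 'C(b v, ij.2)))%C *
     mon (upd b u v ((b u - ij.1) + (b v - ij.2)) (ij.1 + ij.2)) z).
Proof.
move=> uv; rewrite mon_mix// !exprDn mulrA big_distrlr pair_bigA /= mulr_suml.
apply: eq_bigr => -[i j] _ /=.
rewrite mon_upd// !exprMn !exprD.
move: (rest b u v z) (zcoord z u ^+ (b u - i)) (zcoord z v ^+ i) (zcoord z u ^+ (b v - j))
  (zcoord z v ^+ j) (c%:C%C ^+ (b u - i)) ((0 +i* s)%C ^+ i) ((0 +i* s)%C ^+ (b v - j))
  (c%:C%C ^+ j) ('C(b u, i)) ('C(b v, j)) => *.
by rewrite !(mulrnAl, mulrnAr); congr (_ *+ _ *+ _); ring.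
Qed.

(** With W = [mix u v c s] and a0 the collapsed a, the pairing of phi (z^a0 o W) with z^b equals
    that of phi z^a0 with z^b o W^-1. After binomial expansion one term survives on each side. The
    common factor (i s)^(a u) c^(a v) cancels, and the binomial coefficient remains on one side
    only. *)
Lemma elt_collapse phi p a b u v :
  bounded phi -> torus_type phi p -> mix_invariant phi u v -> u != v ->
  p u = 0 -> a u = b u -> a v = b v ->
  (\sum_(i < n) a i <= m)%N -> (\sum_(i < n) b i <= m)%N ->
  'C(a u + a v, a u)%:R * elt m phi a b = elt m phi (collapse u v a) (collapse u v b).
Proof.
move=> bp tp ip uv pu abu abv am bm.
(* Any rotation with c != 0 and s != 0 would do. *)
pose c : R := 4 / 5; pose s : R := 3 / 5.
have cs : c ^+ 2 + s ^+ 2 = 1 by rewrite /c /s; field.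
have c1 : c != -1 by apply/eqP; rewrite /c; lra.
have csN : c ^+ 2 + (- s) ^+ 2 = 1 by rewrite sqrrN.
set a0 := collapse u v a.
have a0m : (\sum_(i < n) a0 i <= m)%N by rewrite (@sum_upd a u v 0 (a u + a v) xpredT)// add0n.
have adm i : (i <= a u + a v)%N ->
    (\sum_(j < n) upd a u v i (a u + a v - i) j <= m)%N.
  by move=> ij; rewrite (@sum_upd a u v _ _ xpredT)// subnKC.
have bdm i j : (i <= b u)%N -> (j <= b v)%N ->
    (\sum_(k < n) upd b u v ((b u - i) + (b v - j)) (i + j) k <= m)%N.
  by move=> iu jv; rewrite (@sum_upd b u v _ _ xpredT)// addnACA !subnK.
have g0 := growth_bounded_mon bp a0m.
have gb := growth_mon R bm.
pose H z := mon b (mix u v c (- s) z).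
have mH : cmeasurable H.
  by apply: cmeasurable_comp; [case: gb|case: (mpres_mix u v csN c1)].
have HW z : H (mix u v c s z) = mon b z by rewrite /H mixK.
(* Change of variables: the mixing leaves phi and the weight unchanged and undoes the inverse mixing
   inside [H]. *)
have L : inner m (fun z => phi z * mon a0 z) H =
  inner m (fun z => phi z * mon a0 (mix u v c s z)) (mon b).
  rewrite -(inner_mpres m (mpres_mix u v cs c1) _ (proj1 g0) mH); last first.
    by move=> z; exact: normsq_mix.
  rewrite (_ : H \o _ = mon b); last by apply/funext => z; exact: HW.
  apply: inner_ae.
  - by apply: cmeasurable_comp; [case: g0|case: (mpres_mix u v cs c1)].
  - apply: cmeasurableM; first by case: bp.
    by apply: cmeasurable_comp; [exact: cmeasurable_mon|case: (mpres_mix u v cs c1)].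
  - by case: gb.
  - by apply: filterS (ip c s cs c1) => z /= ->.
have E1 : inner m (fun z => phi z * mon a0 (mix u v c s z)) (mon b) =
    (c%:C ^+ a v * (0 +i* s) ^+ a u *+ 'C(a u + a v, a u))%C * elt m phi a b.
  pose co (i : 'I_(a u + a v).+1) : R[i] :=
    (c%:C ^+ (a u + a v - i) * (0 +i* s) ^+ i *+ 'C(a u + a v, i))%C.
  have -> : (fun z => phi z * mon a0 (mix u v c s z)) = (fun z =>
      \sum_(i < (a u + a v).+1) co i * (phi z * mon (upd a u v i (a u + a v - i)) z)).
    apply/funext => z; rewrite mon_collapse_mix// mulr_sumr.
    by apply: eq_bigr => i _; rewrite mulrCA.
  rewrite inner_suml//; last by move=> i; apply: growth_bounded_mon => //; rewrite adm// -ltnS.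
  have au : (a u < (a u + a v).+1)%N by rewrite ltnS leq_addr.
  (* Torus weights kill every term except the one whose z_u-exponent is b u = a u. *)
  rewrite (bigD1 (Ordinal au))//= big1 ?addr0 => [|i iau]; last first.
    apply/eqP; rewrite mulf_eq0; apply/orP; right; apply: contraNT iau => E0.
    have := elt_neq0 bp tp _ bm E0 u; rewrite adm; last by rewrite -ltnS.
    rewrite /upd eqxx pu addr0 => /(_ isT) [] ai.
    by apply/eqP/val_inj; exact: etrans (esym ai) (esym abu).
  rewrite /co /= addKn (_ : upd a u v (a u) (a v) = a)//.
  apply/funext => i; rewrite /upd; case: eqP => [->//|_].
  by case: eqP => [->//|].
have E2 : inner m (fun z => phi z * mon a0 z) H =
    (conjc ((0 +i* - s) ^+ a u * c%:C ^+ a v))%C * elt m phi a0 (collapse u v b).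
  pose co (ij : 'I_(b u).+1 * 'I_(b v).+1) : R[i] :=
    (c%:C ^+ (b u - ij.1) * (0 +i* - s) ^+ ij.1 *+ 'C(b u, ij.1) *
      ((0 +i* - s) ^+ (b v - ij.2) * c%:C ^+ ij.2 *+ 'C(b v, ij.2)))%C.
  have -> : H = (fun z => \sum_ij co ij *
      mon (upd b u v ((b u - ij.1) + (b v - ij.2)) (ij.1 + ij.2)) z).
    by apply/funext => z; rewrite /H mon_mix_sum.
  rewrite inner_sumr//; last first.
    by move=> -[i j]; apply: growth_mon; apply: bdm; rewrite -ltnS /=.
  (* Here p u = 0 forces the z_u-exponent to be 0, that of [a0]: only the term taking z_v from every
     factor of both powers is left. *)
  rewrite (bigD1 (ord_max, ord_max))//= big1 ?addr0 => [|[i j] ij]; last first.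
    apply/eqP; rewrite mulf_eq0; apply/orP; right; apply: contraNT ij => E0.
    have := elt_neq0 bp tp a0m _ E0 u; rewrite bdm; [|by rewrite -ltnS..].
    rewrite /a0 /collapse /upd eqxx pu addr0 => /(_ isT) [] /eqP.
    rewrite addn_eq0 !subn_eq0 /= => /andP[bi bj].
    by apply/eqP; congr (_, _); apply/val_inj/eqP; rewrite eqn_leq /= -ltnS ltn_ord.
  rewrite !subnn /= addn0 -/(collapse u v b) -/(elt m phi a0 _).
  by rewrite /co /= !subnn !binn !expr0 !mulr1n mul1r mul1r abu abv.
have e0 : ((0 +i* s) ^+ a u * c%:C ^+ a v)%C != 0 :> R[i].
  rewrite mulf_neq0 ?expf_neq0// eq_complex /= negb_and.
    by rewrite orbC (_ : s != 0)// /s; apply/eqP; lra.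
  by rewrite (_ : c != 0)// /c; apply/eqP; lra.
have cj : conjc ((0 +i* - s) ^+ a u * c%:C ^+ a v)%C = ((0 +i* s) ^+ a u * c%:C ^+ a v)%C.
  rewrite rmorphM; congr (_ * _); rewrite rmorphXn; congr (_ ^+ _);
    by apply/eqP; rewrite eq_complex /= ?opprK ?oppr0 !eqxx.
apply: (mulfI e0); move: L; rewrite E1 E2 cj => ->.
by rewrite -mulr_natr; ring.
Qed.

End collapse.

(** * Normalised coefficients and their dependence on block degrees *)

Section coefficients.
Variables (R : realType) (n m : nat).
Implicit Types (z : Cn R n) (phi psi : Cn R n -> R[i]) (a b : 'I_n -> nat) (p q : 'I_n -> int).
Implicit Types (u v : 'I_n) (A B : {set 'I_n}).

(** Entry of T_phi in the monomial basis, which is orthogonal for nu_m. The squared norm below is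
    itself a matrix element, that of the constant symbol 1, so [elt_collapse] applies to numerator
    and denominator. *)
Definition coef phi a b : R[i] := elt m phi a b / elt m (fun=> 1) b b.

Lemma bounded1 : bounded (fun=> 1 : R[i]) (n := n).
Proof.
split; first exact: cmeasurable_cst.
by exists 1; apply: aeW => z; rewrite ComplexField.Normc.normc1.
Qed.

Lemma torus_type1 : torus_type (fun=> 1 : R[i]) (fun _ : 'I_n => 0).
Proof. by move=> u c s _ _; apply: aeW => z; rewrite expr0z mul1r. Qed.

Lemma mix_invariant1 u v : mix_invariant (fun=> 1 : R[i]) u v.
Proof. by move=> c s _ _; apply: aeW. Qed.

Lemma coef_neq0 phi p a b : bounded phi -> torus_type phi p ->
  (\sum_(i < n) a i <= m)%N -> (\sum_(i < n) b i <= m)%N ->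
  coef phi a b != 0 -> forall u, (b u)%:Z = (a u)%:Z + p u.
Proof.
move=> bp tp am bm; rewrite mulf_eq0 negb_or => /andP[E0 _].
exact: (elt_neq0 bp tp am bm E0).
Qed.

Lemma elt1_neq0 a : (\sum_(i < n) a i <= m)%N -> elt m (fun=> 1) a a != 0 :> R[i].
Proof.
move=> am; rewrite /elt (_ : (fun z => 1 * mon a z) = mon a); first exact: inner_mon_neq0.
by apply/funext => z; rewrite mul1r.
Qed.

Lemma sum_collapse a u v : u != v -> (\sum_(i < n) collapse u v a i = \sum_(i < n) a i)%N.
Proof. by move=> uv; apply: sum_upd => //; rewrite add0n. Qed.

(** As a and b agree at u and v, [elt_collapse] produces the same binomial coefficient for phi and
    for the symbol 1, and it cancels. *)
Lemma coef_collapse phi p a b u v :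
  bounded phi -> torus_type phi p -> mix_invariant phi u v -> u != v ->
  p u = 0 -> a u = b u -> a v = b v ->
  (\sum_(i < n) a i <= m)%N -> (\sum_(i < n) b i <= m)%N ->
  coef phi a b = coef phi (collapse u v a) (collapse u v b).
Proof.
move=> bp tp ip uv pu abu abv am bm; rewrite /coef.
rewrite -(elt_collapse bp tp ip uv pu abu abv am bm).
rewrite -(elt_collapse bounded1 torus_type1 (mix_invariant1 u v) uv erefl erefl erefl bm bm).
rewrite abu abv invfM mulrACA mulfV ?mul1r// pnatr_eq0 -lt0n bin_gt0.
by rewrite leq_addr.
Qed.

Definition collapse_seq v (s : seq 'I_n) a := foldl (fun a u => collapse u v a) a s.

(** Of the values on v :: s, only their total survives the successive collapses onto v. *)
Lemma collapse_seqE v s a : uniq (v :: s) ->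
  collapse_seq v s a = fun i => if i \in s then 0%N else
    if i == v then (a v + \sum_(j <- s) a j)%N else a i.
Proof.
elim: s a => [|u s IH] a /=.
  by move=> _; apply/funext => i; rewrite big_nil addn0; case: eqP => // ->.
rewrite inE negb_or -andbA => /and4P[vu vs us s_uniq].
have {IH} := IH (collapse u v a); rewrite /= vs s_uniq => /(_ isT) IH.
rewrite /collapse_seq /= -/(collapse_seq _ _ _) IH; apply/funext => i.
rewrite inE big_cons /collapse /upd eqxx (negbTE vu).
case: (boolP (i \in s)) => [_|si]; first by rewrite orbT.
rewrite orbF; case: (eqVneq i v) => [->|iv].
  rewrite (negbTE vu) [(a u + a v)%N in LHS]addnC -addnA; congr (_ + (_ + _))%N.
  rewrite big_seq [RHS]big_seq; apply: eq_bigr => j js.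
  case: eqP => [ju|_]; first by move: us; rewrite -ju js.
  by case: eqP => // jv; move: vs; rewrite -jv js.
by case: ifP.
Qed.

Lemma coef_collapse_seq phi p a b v s :
  bounded phi -> torus_type phi p -> v \notin s ->
  (forall u, u \in s -> mix_invariant phi u v) ->
  (forall u, u \in s -> p u = 0) -> a v = b v -> {in s, a =1 b} ->
  (\sum_(i < n) a i <= m)%N -> (\sum_(i < n) b i <= m)%N ->
  coef phi a b = coef phi (collapse_seq v s a) (collapse_seq v s b).
Proof.
move=> bp tp; elim: s a b => [//|u s IH] a b.
rewrite inE negb_or eq_sym => /andP[uv vs] ip p0 abv ab am bm.
have us : u \in u :: s by rewrite mem_head.
rewrite (coef_collapse bp tp (ip _ us) uv (p0 _ us) (ab _ us) abv am bm).
rewrite /collapse_seq /= -!/(collapse_seq _ _ _).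
have sub w : w \in s -> w \in u :: s by rewrite inE orbC => ->.
apply: IH; rewrite ?sum_collapse//.
- by move=> w /sub; exact: ip.
- by move=> w /sub; exact: p0.
- by rewrite /collapse /upd eqxx (ab _ us) abv.
- by move=> w ws; rewrite /collapse /upd (ab _ us) abv (ab _ (sub _ ws)).
Qed.

(** Both pairs collapse, onto a chosen v of B, to the same normal form, which retains only the
    exponents outside B and the sum over B. *)
Lemma coef_block phi p a b a' b' B :
  bounded phi -> torus_type phi p ->
  {in B &, forall u v, u != v -> mix_invariant phi u v} ->
  {in B, forall u, p u = 0} ->
  {in B, a =1 b} -> {in B, a' =1 b'} ->
  (forall u, u \notin B -> a u = a' u) -> (forall u, u \notin B -> b u = b' u) ->
  (\sum_(u in B) a u = \sum_(u in B) a' u)%N ->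
  (\sum_(i < n) a i <= m)%N -> (\sum_(i < n) b i <= m)%N ->
  (\sum_(i < n) a' i <= m)%N -> (\sum_(i < n) b' i <= m)%N ->
  coef phi a b = coef phi a' b'.
Proof.
move=> bp tp ip p0 ab ab' aa' bb' saa' am bm am' bm'.
have [B0|[v vB]] := set_0Vmem B.
  have -> : a = a' by apply/funext => u; apply: aa'; rewrite B0 inE.
  by have -> : b = b' by apply/funext => u; apply: bb'; rewrite B0 inE.
pose s := enum (B :\ v).
have sB u : u \in s -> u \in B /\ u != v by rewrite mem_enum !inE => /andP[].
have vs : v \notin s by rewrite mem_enum !inE eqxx.
have us : uniq (v :: s) by rewrite /= vs enum_uniq.
have ips u : u \in s -> mix_invariant phi u v by move=> /sB[uB uv]; exact: ip.
have ps u : u \in s -> p u = 0 by move=> /sB[uB _]; exact: p0.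
have sumE c : (c v + \sum_(j <- s) c j = \sum_(u in B) c u)%N.
  rewrite (bigD1 v vB) /=; congr addn; rewrite big_enum /=.
  by apply: eq_bigl => i; rewrite !inE andbC.
have E c c' : (forall u, u \notin B -> c u = c' u) ->
    (\sum_(u in B) c u = \sum_(u in B) c' u)%N -> collapse_seq v s c = collapse_seq v s c'.
  move=> cc' scc'; rewrite !collapse_seqE//; apply/funext => i.
  case: ifPn => // si; rewrite !sumE scc'; case: eqP => // /eqP iv.
  by apply: cc'; apply: contra si => iB; rewrite mem_enum !inE iv.
rewrite (coef_collapse_seq bp tp vs ips ps)//; [|exact: ab|by move=> u /sB[uB _]; exact: ab].
rewrite (coef_collapse_seq bp tp vs ips ps (a := a'))//; [|exact: ab'|by move=> u /sB[uB _]; exact: ab'].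
(* The sums of b and b' over B are those of a and a', with which they agree there. *)
rewrite (E _ _ aa' saa') (E _ _ bb')// -(eq_bigr _ ab) saa'; exact: eq_bigr.
Qed.

End coefficients.

(** * Toeplitz operators in the monomial basis *)

Section toeplitz_matrix.
Variables (R : realType) (n m : nat).
Implicit Types (z : Cn R n) (phi psi : Cn R n -> R[i]) (p q : 'I_n -> int).
Implicit Types (u v : 'I_n) (A B : {set 'I_n}).

(** [bmultinom] bounds the degree strictly: with the bound m+1 its elements are the exponents of
    degree at most m. *)
Local Notation index := (mpoly.bmultinom n m.+1).

Definition expo (i : index) : 'I_n -> nat := mpoly.fun_of_multinom (mpoly.bmnm i).

Lemma sum_expo i : (\sum_(u < n) expo i u <= m)%N.
Proof. by rewrite /expo -mpoly.mdegE -ltnS; exact: mpoly.bmdeg. Qed.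

Lemma expo_inj i j : expo i =1 expo j -> i = j.
Proof. by move=> ij; apply/val_inj/mpoly.mnmP. Qed.

Lemma expo_surj (a : 'I_n -> nat) : (\sum_(u < n) a u <= m)%N -> exists i, expo i = a.
Proof.
move=> am; pose M := mpoly.Multinom [tuple a u | u < n].
have MA u : mpoly.fun_of_multinom M u = a u by exact: mpoly.mnmE.
have Mm : (mpoly.mdeg M < m.+1)%N.
  by rewrite mpoly.mdegE ltnS; under eq_bigr do rewrite MA.
by exists (mpoly.BMultinom Mm); apply/funext => u; exact: MA.
Qed.

Definition comb (c : index -> R[i]) z : R[i] := \sum_i c i * mon (expo i) z.

Lemma bergman_comb c : bergman m (comb c).
Proof.
exists (\sum_i c i *: mpoly.mpolyX R[i] (mpoly.bmnm i)); split.
  apply: leq_trans (mpoly.mmeasure_sum _ _ _ _) _.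
  apply/bigmax_leqP => i _; apply: leq_trans (mpoly.msizeZ_le _ _) _.
  by rewrite mpoly.msizeX; exact: mpoly.bmdeg.
apply/funext => z; rewrite raddf_sum; apply: eq_bigr => i _.
by rewrite /= mpoly.mevalZ mpoly.mevalX.
Qed.

Lemma bergmanP f : bergman m f -> exists c, f = comb c.
Proof.
move=> [P [Pm ->]]; exists (fun i => mpoly.mcoeff (mpoly.bmnm i) P).
apply/funext => z; rewrite {1}[P](mpoly.mpolywE Pm) raddf_sum.
by apply: eq_bigr => i _; rewrite /= mpoly.mevalZ mpoly.mevalX.
Qed.

Lemma growth_comb c : growth m (comb c).
Proof.
apply: growth_sum => i _; apply: growthZ; apply: growth_mon; exact: sum_expo.
Qed.

(** Orthogonality of the monomials is [elt_neq0] for the constant symbol 1, of torus weight 0. *)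
Lemma inner_comb_mon c j :
  inner m (comb c) (mon (expo j)) = c j * elt m (fun=> 1) (expo j) (expo j).
Proof.
rewrite inner_suml; last 2 first.
- by move=> i; apply: growth_mon; exact: sum_expo.
- by apply: growth_mon; exact: sum_expo.
have E i : inner m (mon (expo i)) (mon (expo j)) = elt m (fun=> 1 : R[i]) (expo i) (expo j).
  by rewrite /elt (_ : (fun z => 1 * mon (expo i) z) = mon (expo i))//; apply/funext => z; rewrite mul1r.
rewrite (bigD1 j)//= E big1 ?addr0// => i ij; rewrite E.
apply/eqP; rewrite mulf_eq0; apply/orP; right; apply: contraNT ij => E0.
apply/eqP/expo_inj => u; apply/esym/eqP; rewrite -eqz_nat; apply/eqP.
by rewrite (elt_neq0 (@bounded1 R n) (@torus_type1 R n) (sum_expo i) (sum_expo j) E0) addr0.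
Qed.

Lemma growth_residual phi c d : bounded phi ->
  growth m (fun z => phi z * comb c z + (-1) * comb d z).
Proof.
move=> bp; apply: growthD; first by apply: bounded_growthM => //; exact: growth_comb.
by apply: growthZ; exact: growth_comb.
Qed.

(** The squared norm on the right being nonzero, this pairing vanishes exactly when d j is the sum;
    that yields both existence and uniqueness of the projection. *)
Lemma inner_residual phi c d j : bounded phi ->
  inner m (fun z => phi z * comb c z - comb d z) (mon (expo j)) =
  (\sum_i c i * coef m phi (expo i) (expo j) - d j) * elt m (fun=> 1) (expo j) (expo j).
Proof.
move=> bp; rewrite (_ : (fun z => _) = (fun z =>
  (\sum_i c i * (phi z * mon (expo i) z)) + (-1) * comb d z)); last first.
  apply/funext => z; rewrite mulN1r; congr (_ - _).
  by rewrite /comb mulr_sumr; apply: eq_bigr => i _; rewrite mulrCA.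
have gj : growth m (mon (expo j) : Cn R n -> _) by apply: growth_mon; exact: sum_expo.
have gi i : growth m (fun z => phi z * mon (expo i) z).
  by apply: growth_bounded_mon => //; exact: sum_expo.
rewrite innerDl//; last 2 first.
- by apply: growth_sum => i _; exact: growthZ.
- by apply: growthZ; exact: growth_comb.
rewrite innerZl//; last exact: growth_comb.
rewrite inner_comb_mon inner_suml// mulrBl mulr_suml mulN1r; congr (_ - _).
apply: eq_bigr => i _; rewrite /coef -!mulrA mulVf ?mulr1//.
by apply: elt1_neq0; exact: sum_expo.
Qed.

Lemma toeplitz_comb phi c : bounded phi ->
  toeplitz m phi (comb c) = comb (fun j => \sum_i c i * coef m phi (expo i) (expo j)).
Proof.
(* An element with the defining property is exhibited, so the default 0 is not taken; any other one
   has the same coefficients, by testing against monomials. *)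
move=> bp; rewrite /toeplitz /bproj; apply: xget_unique.
  split; first exact: bergman_comb.
  move=> h /bergmanP[e ->]; rewrite /comb inner_sumr; last 2 first.
  - have := growth_residual c (fun j => \sum_i c i * coef m phi (expo i) (expo j)) bp.
    by congr growth; apply/funext => z; rewrite mulN1r.
  - by move=> i; apply: growth_mon; exact: sum_expo.
  by rewrite big1// => j _; rewrite -!/(comb _ _) inner_residual// subrr mul0r mulr0.
move=> g [/bergmanP[d ->] ortho]; congr comb; apply/funext => j; apply/esym/eqP.
have jm := sum_expo j.
have := ortho (mon (expo j)); rewrite inner_residual// => /(_ _)/eqP.
rewrite mulf_eq0 (negbTE (elt1_neq0 R jm)) orbF subr_eq0; apply.
have -> : mon (expo j) = comb (fun i => (i == j)%:R).
  apply/funext => z; rewrite /comb (bigD1 j)//= eqxx mul1r big1 ?addr0// => i /negbTE ->.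
  by rewrite mul0r.
exact: bergman_comb.
Qed.

(** If b = a + p + q with p supported in A and q away from A, this is a + p, the exponent between
    the two shifts. Taking its entries from a and b keeps them natural numbers although p may have
    negative entries. *)
Definition swap A (a b : 'I_n -> nat) : 'I_n -> nat := fun u => if u \in A then b u else a u.

Lemma eq_sum_shift (P : pred 'I_n) p (a b : 'I_n -> nat) :
  (forall u, P u -> (b u)%:Z = (a u)%:Z + p u) -> \sum_(u | P u) p u = 0 ->
  (\sum_(u | P u) b u = \sum_(u | P u) a u)%N.
Proof.
move=> ab p0; apply/eqP; rewrite -eqz_nat !(big_morph Posz PoszD erefl).
by rewrite (eq_bigr _ ab) big_split /= p0 addr0.
Qed.

Lemma sum_supp A p : (forall u, u \notin A -> p u = 0) -> \sum_(u in A) p u = 0 ->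
  \sum_u p u = 0.
Proof.
by move=> p0 sp; rewrite (bigID (mem A)) /= sp add0r big1.
Qed.

Section swap.
Variables (A B : {set 'I_n}) (p q : 'I_n -> int).
Hypothesis AB : [disjoint A & B]%B.
Hypotheses (pA : forall u, u \notin A -> p u = 0) (qB : forall u, u \notin B -> q u = 0).
Hypotheses (sp : \sum_(u in A) p u = 0).
Variables a b : 'I_n -> nat.
Hypothesis ab : forall u, (b u)%:Z = (a u)%:Z + (p u + q u).

Lemma swapE u : (swap A a b u)%:Z = (a u)%:Z + p u.
Proof.
rewrite /swap; case: ifPn => uA; last by rewrite pA ?addr0.
by rewrite ab [q u]qB ?addr0// (disjointFr AB uA).
Qed.

(** This is what keeps the intermediate exponent within degree m. *)
Lemma sum_swap : (\sum_(u < n) swap A a b u = \sum_(u < n) a u)%N.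
Proof.
apply: (eq_sum_shift (p := p)) => [u _|]; first exact: swapE.
exact: sum_supp pA sp.
Qed.

End swap.

(** Torus weights leave at most one path from i through j to k, the one whose middle exponent is
    that of i plus p. *)
Lemma sum_coefM phi psi p q A B i k : bounded phi -> bounded psi ->
  torus_type phi p -> torus_type psi q -> [disjoint A & B]%B ->
  (forall u, u \notin A -> p u = 0) -> (forall u, u \notin B -> q u = 0) ->
  \sum_(u in A) p u = 0 ->
  \sum_j coef m phi (expo i) (expo j) * coef m psi (expo j) (expo k) =
  if [forall u, (expo k u)%:Z == (expo i u)%:Z + (p u + q u)] then
    coef m phi (expo i) (swap A (expo i) (expo k)) *
    coef m psi (swap A (expo i) (expo k)) (expo k)
  else 0.
Proof.
move=> bp bq tp tq AB pA qB sp.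
have key j : coef m phi (expo i) (expo j) * coef m psi (expo j) (expo k) != 0 ->
    (forall u, (expo j u)%:Z = (expo i u)%:Z + p u) /\
    (forall u, (expo k u)%:Z = (expo j u)%:Z + q u).
  rewrite mulf_eq0 negb_or => /andP[c1 c2]; split.
    exact: coef_neq0 bp tp (sum_expo _) (sum_expo _) c1.
  exact: coef_neq0 bq tq (sum_expo _) (sum_expo _) c2.
case: ifPn => [/forallP ik|/negP ik]; last first.
  apply: big1 => j _; apply/eqP; apply: contra_notT ik => /key[ij jk].
  by apply/forallP => u; rewrite jk ij addrA.
have {}ik u : (expo k u)%:Z = (expo i u)%:Z + (p u + q u) by apply/eqP/ik.
have [j jE] : exists j, expo j = swap A (expo i) (expo k).
  by apply: expo_surj; rewrite (sum_swap AB pA qB sp ik); exact: sum_expo.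
rewrite (bigD1 j)//= big1 ?addr0 ?jE// => j' jj'.
apply/eqP; apply: contraNT jj' => /key[ij' _]; apply/eqP/expo_inj => u.
by apply/eqP; rewrite jE -eqz_nat (swapE AB pA qB ik) ij'.
Qed.

(** The same shift by p, carried out before and after the shift by q: the steps a -> a + p and a + q
    -> a + p + q differ only on B, where q has sum 0, so [coef_block] applies. *)
Lemma coef_swap psi p q A B i k : bounded psi -> torus_type psi p -> [disjoint A & B]%B ->
  (forall u, u \notin A -> p u = 0) -> (forall u, u \notin B -> q u = 0) ->
  \sum_(u in A) p u = 0 -> \sum_(u in B) q u = 0 ->
  {in B &, forall u v, u != v -> mix_invariant psi u v} ->
  (forall u, (expo k u)%:Z = (expo i u)%:Z + (p u + q u)) ->
  coef m psi (expo i) (swap A (expo i) (expo k)) =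
  coef m psi (swap B (expo i) (expo k)) (expo k).
Proof.
move=> bp tp AB pA qB sp sq ip ik.
have BA : [disjoint B & A]%B by rewrite disjoint_sym.
have ki u : (expo k u)%:Z = (expo i u)%:Z + (q u + p u) by rewrite ik [p u + _]addrC.
have pB u : u \in B -> p u = 0 by move=> uB; rewrite pA// (disjointFl AB uB).
apply: (coef_block (B := B) bp tp ip) => //.
- by move=> u uB; rewrite /swap (disjointFl AB uB).
- by move=> u uB; rewrite /swap uB.
- by move=> u uB; rewrite /swap (negbTE uB).
- move=> u uB; rewrite /swap; case: ifPn => // uA.
  by apply/eqP; rewrite -eqz_nat ik pA// qB// !addr0.
- apply/esym/(eq_sum_shift (p := q)) => // u uB.
  by rewrite /swap uB ik pB// add0r.
- exact: sum_expo.
- by rewrite (sum_swap AB pA qB sp ik) sum_expo.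
- by rewrite (sum_swap BA qB pA sq ki) sum_expo.
- exact: sum_expo.
Qed.

Lemma toeplitz_commute_types phi psi p q A B : bounded phi -> bounded psi ->
  torus_type phi p -> torus_type psi q -> [disjoint A & B]%B ->
  (forall u, u \notin A -> p u = 0) -> (forall u, u \notin B -> q u = 0) ->
  \sum_(u in A) p u = 0 -> \sum_(u in B) q u = 0 ->
  {in B &, forall u v, u != v -> mix_invariant phi u v} ->
  {in A &, forall u v, u != v -> mix_invariant psi u v} ->
  toeplitz_commute m phi psi.
Proof.
move=> bp bq tp tq AB pA qB sp sq ip iq f /bergmanP[c ->].
have BA : [disjoint B & A]%B by rewrite disjoint_sym.
rewrite !toeplitz_comb//; congr comb; apply/funext => k.
under eq_bigr do rewrite mulr_suml.
under [RHS]eq_bigr do rewrite mulr_suml.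
rewrite exchange_big [RHS]exchange_big /=; apply: eq_bigr => i _.
under eq_bigr do rewrite -mulrA.
under [RHS]eq_bigr do rewrite -mulrA.
rewrite -!mulr_sumr; congr (_ * _).
rewrite (sum_coefM i k bp bq tp tq AB pA qB sp) (sum_coefM i k bq bp tq tp BA qB pA sq).
have -> : [forall u, (expo k u)%:Z == (expo i u)%:Z + (p u + q u)] =
    [forall u, (expo k u)%:Z == (expo i u)%:Z + (q u + p u)].
  by apply: eq_forallb => u; rewrite [p u + _]addrC.
case: ifPn => // /forallP ki.
have {}ki u : (expo k u)%:Z = (expo i u)%:Z + (q u + p u) by apply/eqP/ki.
have ik u : (expo k u)%:Z = (expo i u)%:Z + (p u + q u) by rewrite ki [q u + _]addrC.
(* Opposite sides of the square a, a + p, a + p + q, a + q carry equal coefficients, so its two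
   paths give the same product. *)
rewrite (coef_swap bp tp AB pA qB sp sq ip ik) (coef_swap bq tq BA qB pA sq sp iq ki).
by rewrite mulrC.
Qed.

End toeplitz_matrix.

(** * Quasi-radial and block symbols *)

Lemma Linfty_bounded (R : realType) n (phi : Cn R n -> R[i]) :
  Linfty (dV R n) setT phi -> bounded phi.
Proof.
move=> [m1 m2 [M phiM]]; split => //; exists M.
by apply: filterS phiM => z; exact.
Qed.

Section symbols.
Variables (R : realType) (n l : nat) (k : 'I_l -> nat).
Hypothesis kn : (\sum_(j < l) k j)%N = n.
Implicit Types (z : Cn R n) (u v w : 'I_n) (j : 'I_l).

Local Notation idx := (block_index kn).

Lemma block_index_inj j (i i' : 'I_(k j)) : idx i = idx i' -> i = i'.
Proof.
move=> /cast_ord_inj/(congr1 (@nat_of_ord _)).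
by rewrite !tagnat.RankEsum => /eqP; rewrite eqn_add2l => /eqP/val_inj.
Qed.

Lemma block_index_block j j' (i : 'I_(k j)) (i' : 'I_(k j')) : idx i = idx i' -> j = j'.
Proof.
by move=> /cast_ord_inj e; rewrite -(tagnat.Rank1K i) e tagnat.Rank1K.
Qed.

Definition blockset j : {set 'I_n} := [set idx i | i : 'I_(k j)].

Lemma blockset_disjoint j j' : j != j' -> [disjoint blockset j & blockset j']%B.
Proof.
move=> jj'; apply/pred0P => u /=; apply/negbTE/negP => /andP[/imsetP[i _ ->] /imsetP[i' _]].
by move=> /block_index_block /eqP; rewrite (negbTE jj').
Qed.

Lemma sum_blockset (V : nmodType) j (f : 'I_n -> V) :
  \sum_(u in blockset j) f u = \sum_(i < k j) f (idx i).
Proof.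
rewrite big_imset//= => i i' _ _; exact: block_index_inj.
Qed.

(** The weight of a block symbol on the full torus. As [block_index] is injective, the sum has at
    most one term, and none outside the block. *)
Definition extend j (p : (k j).-tuple int) u : int := \sum_(i < k j | idx i == u) tnth p i.

Lemma extend_out j (p : (k j).-tuple int) u : u \notin blockset j -> extend p u = 0.
Proof.
move=> uj; rewrite /extend big_pred0// => i; apply/negP => /eqP iu.
by move/negP: uj; apply; rewrite -iu; apply: imset_f.
Qed.

Lemma sum_extend j (p : (k j).-tuple int) : \sum_(i < k j) tnth p i = 0 ->
  \sum_(u in blockset j) extend p u = 0.
Proof.
move=> p0; rewrite sum_blockset -[RHS]p0; apply: eq_bigr => i _.
rewrite /extend (big_pred1 i)// => i'; apply/eqP/eqP => [/block_index_inj //|->//].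
Qed.

Lemma moduli_rot u (c s : R) z : c ^+ 2 + s ^+ 2 = 1 ->
  moduli (plane_rot u u c s z) = moduli z.
Proof.
by move=> cs; apply: eq_from_tnth => w; rewrite !tnth_mktuple normc_rot.
Qed.

Lemma block_monomial_rot j (p : (k j).-tuple int) u (c s : R) z : c ^+ 2 + s ^+ 2 = 1 ->
  block_monomial kn p (plane_rot u u c s z) = (c +i* s)%C ^ extend p u * block_monomial kn p z.
Proof.
move=> cs; set e := (c +i* s)%C.
have e0 : e != 0.
  apply/eqP => /(congr1 (fun x => normc x)); rewrite ComplexField.Normc.normc0 /normc /= cs sqrtr1.
  by move=> /eqP; rewrite oner_eq0.
have -> : e ^ extend p u = \prod_(i < k j) (if idx i == u then e ^ tnth p i else 1).
  by rewrite -big_mkcond /extend; apply: (big_morph (exprz e)) => // x y; rewrite expfzDr.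
rewrite -big_split; apply: eq_bigr => i _ /=.
rewrite /tcoord normc_rot// zcoord_rot_diag; case: eqP => _; last by rewrite mul1r.
by rewrite -mulrA expfzMl.
Qed.

Lemma enorm_moduli_mix u v (c s : R) z : u != v -> c ^+ 2 + s ^+ 2 = 1 ->
  enorm (moduli (mix u v c s z)) = enorm (moduli z).
Proof.
move=> uv cs; apply/eqP; rewrite -(@eqrXn2 _ 2) ?sqrtr_ge0// !normsqE.
by rewrite normsq_mix.
Qed.

(** The entries of [sigma] are moduli divided by the full radius, so the invariance of the radius
    enters besides that of the untouched block. *)
Lemma sigma_block_mix j u v (c s : R) z : u != v -> u \notin blockset j -> v \notin blockset j ->
  c ^+ 2 + s ^+ 2 = 1 ->
  block kn (sigma (mix u v c s z)) j = block kn (sigma z) j.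
Proof.
move=> uv uj vj cs; apply: eq_from_tnth => i; rewrite !tnth_mktuple enorm_moduli_mix//.
have ij : idx i \in blockset j by exact: imset_f.
rewrite zcoord_mix//; case: eqP => [iu|_]; first by move: uj; rewrite -iu ij.
by case: eqP => [iv|//]; move: vj; rewrite -iv ij.
Qed.

Lemma block_monomial_mix j (p : (k j).-tuple int) u v (c s : R) z :
  u != v -> u \notin blockset j -> v \notin blockset j ->
  block_monomial kn p (mix u v c s z) = block_monomial kn p z.
Proof.
move=> uv uj vj; apply: eq_bigr => i _.
have ij : idx i \in blockset j by exact: imset_f.
suff E : tcoord (mix u v c s z) (idx i) = tcoord z (idx i) by rewrite E.
rewrite /tcoord zcoord_mix//; case: eqP => [iu|_]; first by move: uj; rewrite -iu ij.
by case: eqP => [iv|//]; move: vj; rewrite -iv ij.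
Qed.

(** The unitary acts within block j, whose norm it preserves, and does not touch the other
    blocks. *)
Lemma enorm_block_mix j j' u v (c s : R) z : u != v ->
  u \in blockset j -> v \in blockset j -> c ^+ 2 + s ^+ 2 = 1 ->
  enorm (block kn (moduli (mix u v c s z)) j') = enorm (block kn (moduli z) j').
Proof.
move=> uv uj vj cs; congr Num.sqrt.
have E z' : \sum_(i < k j') (tnth (block kn (moduli z') j') i : R) ^+ 2 =
    \sum_(u in blockset j') normc (zcoord z' u) ^+ 2.
  by rewrite sum_blockset; apply: eq_bigr => i _; rewrite !tnth_mktuple.
rewrite !E sum_sqr_normc_mix//.
have [<-|jj'] := eqVneq j j'; first by rewrite uj vj.
by rewrite !(disjointFr (blockset_disjoint jj')).
Qed.

Lemma quasi_radial_torus_type (a : Cn R n -> R[i]) : quasi_radial kn a -> torus_type a (fun=> 0).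
Proof.
move=> [_ [a' aE]] u c s cs c1.
(* The representation by [a'] is used at z and at its rotated image; [ae_mpres] justifies the second
   use. *)
apply: filterS2 aE (ae_mpres (mpres_rot u u cs c1) aE) => z az ->.
by rewrite expr0z mul1r az moduli_rot.
Qed.

Lemma quasi_radial_mix (a : Cn R n -> R[i]) j : quasi_radial kn a ->
  {in blockset j &, forall u v, u != v -> mix_invariant a u v}.
Proof.
move=> [_ [a' aE]] u v uj vj uv c s cs c1.
apply: filterS2 aE (ae_mpres (mpres_mix u v cs c1) aE) => z -> ->; congr a'.
by apply: eq_from_tnth => j'; rewrite !tnth_mktuple (enorm_block_mix _ _ uv uj vj cs).
Qed.

Section symbol.
Variables (j : 'I_l) (b : Rn R (k j) -> R[i]) (p : (k j).-tuple int).
Variable psi : Cn R n -> R[i].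
Hypothesis psiE : \forall z \ae dV R n,
  psi z = b (block kn (sigma z) j) * block_monomial kn p z.

Lemma symbol_torus_type : torus_type psi (extend p).
Proof.
move=> u c s cs c1.
apply: filterS2 psiE (ae_mpres (mpres_rot u u cs c1) psiE) => z -> ->.
by rewrite /sigma moduli_rot// block_monomial_rot// mulrCA.
Qed.

Lemma symbol_mix j' : j' != j ->
  {in blockset j' &, forall u v, u != v -> mix_invariant psi u v}.
Proof.
move=> jj' u v uj vj uv c s cs c1.
have dis := blockset_disjoint jj'.
apply: filterS2 psiE (ae_mpres (mpres_mix u v cs c1) psiE) => z -> ->.
have uj' : u \notin blockset j by rewrite (disjointFr dis uj).
have vj' : v \notin blockset j by rewrite (disjointFr dis vj).
by rewrite (sigma_block_mix z uv uj' vj' cs) (block_monomial_mix p c s z uv uj' vj').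
Qed.

End symbol.

End symbols.

Theorem corollary4p3 (R : realType) (n l : nat) (hn : (1 <= n)%N) (hl : (1 <= l)%N)
  (k : 'I_l -> nat) (hk : forall j, (1 <= k j)%N)
  (kn : (\sum_(j < l) k j)%N = n)
  (a : Cn R n -> R[i]) (a_qr : quasi_radial kn a)
  (psi : 'I_l -> Cn R n -> R[i])
  (psi_bounded : forall j, Linfty (dV R n) setT (psi j))
  (b : forall j : 'I_l, Rn R (k j) -> R[i])
  (b_bounded : forall j, Linfty (Sigma_measure R k j) (Sigma R kn j) (b j))
  (p : forall j : 'I_l, (k j).-tuple int)
  (p_sum : forall j, \sum_(i < k j) tnth (p j) i = 0)
  (psiE : forall j, \forall z \ae dV R n,
    psi j z = b j (block kn (sigma z) j) * block_monomial kn (p j) z) :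
  forall m : nat,
    (forall j, toeplitz_commute m a (psi j)) /\
    (forall i j, toeplitz_commute m (psi i) (psi j)).
Proof.
move=> m.
have bp j := Linfty_bounded (psi_bounded j).
have tp j := symbol_torus_type (psiE j).
have out j := @extend_out n l k kn j (p j).
have sum0 j := sum_extend kn (p_sum j).
split=> [j|i j].
  (* The weight 0 is supported on the empty set, which makes the invariance asked of [psi j] on A
     vacuous. *)
  apply: (toeplitz_commute_types (A := finset.set0) (B := blockset kn j)
    (Linfty_bounded (proj1 a_qr)) (bp j) (quasi_radial_torus_type a_qr) (tp j)) => //.
  - by apply/pred0P => u; rewrite !inE.
  - exact: out.
  - by rewrite big1.
  - exact: quasi_radial_mix.
  - by move=> u; rewrite inE.
(* For i = j both sides coincide; disjoint blocks require i != j. *)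
have [<-//|ij] := eqVneq i j.
apply: (toeplitz_commute_types (A := blockset kn i) (B := blockset kn j)
  (bp i) (bp j) (tp i) (tp j) _ (out i) (out j)) => //.
- exact: blockset_disjoint.
- by apply: (symbol_mix (psiE i)); rewrite eq_sym.
- exact: (symbol_mix (psiE j)).
Qed.
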